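(* Let $\mu$ be a finite positive Borel measure on $\mathbb{C}$ with compact and infinite support such that $$\liminf_{n\to\infty}\frac{\kappa_n(\mu)}{\kappa_{n+1}(\mu)}>0.\qquad( * )$$ If $\mathcal{N}\subseteq\mathbb{N}$ is a subsequence, then the following statements are equivalent: (I) There is a sequence of functions $\{f_j\}_{j\in\mathbb{Z}}$, each of which is analytic in $\{z:R_{\mu}<|z|\leq\infty\}$, so that for all $j\in\mathbb{Z}$ $$\lim_{n\to\infty,\ n\in\mathcal{N}}\frac{p_{n+j-1}(z;\mu)}{p_{n+j}(z;\mu)}=f_j(z),\qquad |z|>R_{\mu},$$ where the convergence is uniform on $\{z:|z|>r\}$ for every $r>R_{\mu}$. (II) The matrix $M_{\mu}$ approaches a right limit as $n\to\infty$ through $\mathcal{N}$. Moreover, the implication (II) $\Rightarrow$ (I) is valid even if condition $( * )$ is not satisfied.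
   Context: For a finite positive measure $\mu$ on $\mathbb{C}$ with compact and infinite support, $\{p_n(z;\mu)\}_{n\ge0}$ denotes the sequence of orthonormal polynomials: $p_n(\cdot;\mu)$ has degree $n$, positive leading coefficient $\kappa_n(\mu)>0$, and $\int p_n\overline{p_m}\,d\mu=\delta_{m,n}$. Set $R_\mu=\sup\{|z|:z\in\mathrm{supp}(\mu)\}$. The Bergman Shift matrix $M_\mu$ is the matrix of multiplication by $z$ on the closure of the polynomials in $L^2(\mu)$ in the orthonormal basis $\{p_n\}_{n\ge0}$; its rows and columns are indexed by $\{1,2,3,\ldots\}$, with $(M_\mu)_{i,k}=\int z\,p_{k-1}(z;\mu)\overline{p_{i-1}(z;\mu)}\,d\mu(z)$. A subsequence $\mathcal{N}\subseteq\mathbb{N}$ is an infinite subset of $\mathbb{N}$ (enumerated increasingly). For a matrix $A$ with rows and columns indexed by $\mathbb{N}$, $A_n^{(m)}$ is the $(2m+1)\times(2m+1)$ submatrix of $A$ centered at $A_{n,n}$ (defined for $n>m$). A bi-infinite matrix $X$ (indexed by $\mathbb{Z}$) is a right limit of $A$, and $A$ approaches $X$ through $\mathcal{N}$, if for every $m\in\mathbb{N}$, $\lim_{n\to\infty,\,n\in\mathcal{N}}A_n^{(m)}=X_0^{(m)}$, where $X_0^{(m)}$ is the $(2m+1)\times(2m+1)$ submatrix of $X$ centered at $X_{0,0}$. ''$M_\mu$ approaches a right limit through $\mathcal{N}$'' means that such an $X$ exists for $A=M_\mu$ and $\mathcal{N}$. Limits concern only $n$ large enough that all quantities are defined. *)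

(* Defs.v *)
From mathcomp Require Import all_boot all_order all_algebra.
From mathcomp Require Import complex.
From mathcomp Require Import all_classical all_reals all_analysis.

Set Implicit Arguments.
Unset Strict Implicit.
Unset Printing Implicit Defensive.

Import Order.TTheory GRing.Theory Num.Theory.
Import numFieldNormedType.Exports.

Local Open Scope classical_set_scope.
Local Open Scope ring_scope.
Local Open Scope complex_scope.

(* The topology of R[i] is the one that its regular module R[i]^o carries as a
   normed space over R[i]. *)
Definition borelC (R : realType) := g_sigma_algebraType (@open R[i]^o).

(* The library norm `|z| is valued in R[i]; this is the same number in R. *)
Definition modulus (R : realType) (z : R[i]) : R := complex.Re `|z|.

Section measure_on_plane.
Context (R : realType).
Local Notation C := R[i].
Variable mu : {measure set (borelC R) -> \bar R}.

Definition supp : set R[i]^o :=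
  [set z | forall U : set R[i]^o, open_nbhs z U -> (0 < mu U)%E].

Definition outer_radius : R := sup [set modulus z | z in supp].

Definition cintegral (f : C -> C) : C :=
  (\int[mu]_z complex.Re (f z)) +i* (\int[mu]_z complex.Im (f z)).

(* In the order of R[i], 0 < x means that x is real and positive. *)
Definition orthonormal_polynomials (p : nat -> {poly C}) : Prop :=
  [/\ forall n, size (p n) = n.+1,
      forall n, 0 < lead_coef (p n) &
      forall n m, cintegral (fun z => (p n).[z] * ((p m).[z])^*) = (n == m)%:R].

(* Rows and columns are indexed by 1, 2, 3, ...; the values at index 0 are
   irrelevant. *)
Definition bergman_shift (p : nat -> {poly C}) (i k : nat) : C :=
  cintegral (fun z => z * (p k.-1).[z] * ((p i.-1).[z])^*).

End measure_on_plane.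

Definition kappa (R : realType) (p : nat -> {poly R[i]}) (n : nat) : R :=
  complex.Re (lead_coef (p n)).

(* Filter for "n tends to infinity, n in N" *)
Definition through (N : set nat) : set_system nat := within N \oo.

(* Meaningful for m < n *)
Definition centered_submx (T : Type) (A : nat -> nat -> T) (n m : nat) :
    'M[T]_(m.*2.+1) :=
  \matrix_(i, k) A (n + i - m)%N (n + k - m)%N.

Definition centered_submx0 (T : Type) (X : int -> int -> T) (m : nat) :
    'M[T]_(m.*2.+1) :=
  \matrix_(i, k) X (i%:Z - m%:Z) (k%:Z - m%:Z).

Definition approaches_through (R : realType) (A : nat -> nat -> R[i]^o)
    (X : int -> int -> R[i]^o) (N : set nat) : Prop :=
  forall m : nat,
    (fun n => centered_submx A n m) @ through N --> centered_submx0 X m.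

Definition approaches_right_limit (R : realType) (A : nat -> nat -> R[i])
    (N : set nat) : Prop :=
  exists X : int -> int -> R[i], approaches_through A X N.

(* Analyticity in {r < |z| <= oo}: at infinity, w |-> f (1 / w), with a
   suitable value c = f(oo) at w = 0, is analytic near 0. *)
Definition analytic_outside (R : realType) (r : R) (f : R[i] -> R[i]) : Prop :=
  (forall z, r < modulus z -> derivable (f : R[i]^o -> R[i]^o) z 1) /\
  exists c : R[i], \forall w \near (0 : R[i]^o),
    derivable ((fun w => if w == 0 then c else f w^-1) : R[i]^o -> R[i]^o) w 1.

(* p_{n+j-1}(z) / p_{n+j}(z); the absolute values only matter for the finitely
   many n with n + j - 1 < 0. *)
Definition shifted_ratio (R : realType) (p : nat -> {poly R[i]}) (j : int)
    (n : nat) (z : R[i]) : R[i]^o :=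
  (p (absz (n%:Z + j - 1)%R)).[z] / (p (absz (n%:Z + j)%R)).[z].

Definition ratio_asymptotics (R : realType) (p : nat -> {poly R[i]}) (Rmu : R)
    (N : set nat) : Prop :=
  exists f : int -> R[i] -> R[i]^o, forall j : int,
    analytic_outside Rmu (f j) /\
    forall r : R, Rmu < r ->
      {uniform [set z | r < modulus z],
        (fun n => shifted_ratio p j n) @ through N --> f j}.

(* Main.v *)
Require Import Defs.
From mathcomp Require Import all_boot all_order all_algebra.
From mathcomp Require Import complex.
From mathcomp Require Import all_classical all_reals all_analysis.
From mathcomp Require Import measurable_realfun.
From mathcomp Require Import ring lra zify.

(** Let [H] be the matrix of multiplication by [z] in the orthonormal basis
[p] ([hess]), and [B] the largest modulus of a point of the support.  Since
[z * p k] has degree [k + 1], all diagonals of [H] below the first subdiagonal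
vanish, and the subdiagonal itself consists of the numbers
[kappa n / kappa n.+1].

From the matrix to the ratios.  Let [T] be the compression of multiplication
by [z] to the polynomials of degree at most [n] ([trunc n.+1]).  The
polynomials [z * q] and [T q] differ by a multiple of [p n.+1]; solving for
[q] and iterating from [q = p n] gives
  [p n = p n.+1 * \sum_(k < K) c_k / z ^ (k + 1) + (T^K (p n)) / z ^ K],
where [c_k] is the coordinate of [z * T^k (p n)] on [p n.+1].  By Pythagoras
neither [T q] nor that coordinate exceeds the norm of [z * q], which is at
most [B] times that of [q], so the coefficients are at most [B ^ (k + 1)] and
the remainder vanishes when [|z| > B].  This shows at once that [p n] has no
zero there ([orthonormal_neq0]) and that [p n / p n.+1] is a power series in
[1 / z] dominated by one geometric series for all [n] ([ratio_psum]).
Because [H] has a single diagonal below the main one, [c_k] only involves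
entries of [H] at distance at most [k + 1] from the corner, so it converges
along [N] as soon as [H] has a right limit ([cvg_ratio_coef]).  Geometric
domination turns convergence of each coefficient into uniform convergence of
the series ([psum_uniform]), and the limit is again such a series, hence
analytic up to infinity ([analytic_psum_inv]).

From the ratios to the matrix.  Divide the column identity
[z * p (t - 1) = \sum_i H i (t - 1) * p i] by [p (t - d)].  The terms with
[i < t - d] are of order [1 / z] uniformly in [t], and those with [i > t - d]
contain entries below row [t - d] in the same column.  By induction on [d], the
entry in row [t - d] is therefore within [O(1 / z)] of a sequence that
converges along [N]; as [z] may be taken arbitrarily large, the entry itself
converges ([cvg_hess_column]).  Only pointwise convergence of the ratios at
large [z] is used, but their limits must not vanish, and this is where the
lower bound on [kappa n / kappa n.+1] enters ([ratio_far_ge]). *)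

Set Implicit Arguments.
Unset Strict Implicit.
Unset Printing Implicit Defensive.

Import Order.TTheory GRing.Theory Num.Theory.
Import numFieldNormedType.Exports.

Local Open Scope classical_set_scope.
Local Open Scope ring_scope.

(** * The real-valued modulus *)

Section modulus_theory.
Context {R : realType}.
Local Notation C := R[i].
Implicit Types (x y z : C).

(** Passing through this identity lets every estimate be made between real
numbers, where the order is total and linear arithmetic applies. *)
Lemma modulusE z : `|z| = (modulus z)%:C%C.
Proof. by rewrite /modulus RRe_real ?normr_real. Qed.

Lemma modulus_ge0 z : 0 <= modulus z.
Proof. by rewrite -lecR -modulusE normr_ge0. Qed.

Lemma modulusM x y : modulus (x * y) = modulus x * modulus y.
Proof.
by apply: (@complexI R); rewrite rmorphM /= -!modulusE normrM.
Qed.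

Lemma modulusD x y : modulus (x + y) <= modulus x + modulus y.
Proof. by rewrite -lecR rmorphD /= -!modulusE ler_normD. Qed.

Lemma modulusN x : modulus (- x) = modulus x.
Proof. by rewrite /modulus normrN. Qed.

Lemma modulusBC x y : modulus (x - y) = modulus (y - x).
Proof. by rewrite -modulusN opprB. Qed.

Lemma modulus0 : modulus (0 : C) = 0.
Proof. by rewrite /modulus normr0. Qed.

Lemma modulus1 : modulus (1 : C) = 1.
Proof. by rewrite /modulus normr1. Qed.

Lemma modulus_eq0 x : (modulus x == 0) = (x == 0).
Proof. by rewrite -(inj_eq (@complexI R)) -modulusE normr_eq0. Qed.

Lemma modulus_gt0 x : (0 < modulus x) = (x != 0).
Proof. by rewrite lt_neqAle modulus_ge0 andbT eq_sym modulus_eq0. Qed.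

Lemma modulusV x : modulus x^-1 = (modulus x)^-1.
Proof.
by apply: (@complexI R); rewrite fmorphV /= -!modulusE normfV.
Qed.

Lemma modulusX x n : modulus (x ^+ n) = modulus x ^+ n.
Proof. by elim: n => [|n IH]; rewrite ?modulus1// !exprS modulusM IH. Qed.

Lemma modulus_sum (I : Type) (r : seq I) (P : pred I) (F : I -> C) :
  modulus (\sum_(i <- r | P i) F i) <= \sum_(i <- r | P i) modulus (F i).
Proof.
elim/big_ind2 : _ => //; first by rewrite modulus0.
by move=> a b c d ab cd; apply: le_trans (modulusD _ _) (lerD ab cd).
Qed.

Lemma modulus_real (a : R) : modulus (a%:C%C : C) = `|a|.
Proof. by apply: (@complexI R); rewrite -modulusE normc_def /= expr0n addr0 sqrtr_sqr. Qed.

Lemma modulus_conj x : modulus (x^*) = modulus x.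
Proof. by rewrite /modulus norm_conjC. Qed.

Lemma modulus_sqr z : complex.Re (z * z^*) = modulus z ^+ 2.
Proof.
apply: (@complexI R); rewrite rmorphXn /= -modulusE normCK RRe_real //.
by rewrite -normCK rpredX// normr_real.
Qed.

Lemma Re_le_modulus z : `|complex.Re z| <= modulus z.
Proof. by rewrite -lecR -modulusE normc_ge_Re. Qed.

Lemma Im_le_modulus z : `|complex.Im z| <= modulus z.
Proof.
case: z => a b /=; rewrite -lecR -modulusE normc_def /= lecR -sqrtr_sqr.
by rewrite ler_wsqrtr// lerDr sqr_ge0.
Qed.

Lemma modulus_le_ReIm z : modulus z <= `|complex.Re z| + `|complex.Im z|.
Proof.
rewrite {1}[z]complexE; apply: le_trans (modulusD _ _) _.
rewrite modulusM !modulus_real lerD2l// (_ : modulus _ = 1) ?mul1r//.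
by apply: (@complexI R); rewrite -modulusE normc_def /= expr0n expr1n add0r sqrtr1.
Qed.

End modulus_theory.

(** * Convergence in the plane *)

Section topology_of_complex.
Context {R : realType}.
Local Notation C := R[i].

Lemma cvg_modulusP {T : Type} (F : set_system T) {FF : Filter F}
    (f : T -> C^o) (l : C^o) :
  f @ F --> l <-> (forall e : R, 0 < e -> \forall x \near F, modulus (l - f x) < e).
Proof.
split=> [/cvgrPdist_lt h e e0|h].
  have := h e%:C%C; rewrite ltcR => /(_ e0); apply: filterS => x.
  by rewrite modulusE ltcR.
apply/cvgrPdist_lt => e e0.
have ee : e = (complex.Re e)%:C%C by rewrite RRe_real ?gtr0_real.
have := h (complex.Re e); rewrite -ltcR -ee => /(_ e0); apply: filterS => x.
by rewrite {2}ee modulusE ltcR.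
Qed.

Lemma nbhs_modulusP (z : C^o) (A : set C^o) :
  nbhs z A <-> exists2 e : R, 0 < e & forall y, modulus (z - y) < e -> A y.
Proof.
split.
  move=> /nbhs_ballP[e /= e0 h].
  have ee : e = (complex.Re e)%:C%C by rewrite RRe_real ?gtr0_real.
  exists (complex.Re e); first by rewrite -ltcR -ee.
  by move=> y zy; apply: h; rewrite /ball /= ee modulusE ltcR.
move=> [e e0 h]; apply/nbhs_ballP; exists e%:C%C; first by rewrite /= ltcR.
by move=> y; rewrite /ball /= modulusE ltcR; exact: h.
Qed.

Lemma continuous_lipschitz1 (g : C^o -> R) :
  (forall x y, `|g x - g y| <= modulus (x - y)) -> continuous g.
Proof.
move=> gle z; apply: (proj2 (@cvgrPdist_lt _ R^o _ _ (@nbhs_filter C^o z) g (g z))) => e e0.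
by apply/nbhs_modulusP; exists e => // y; apply: le_lt_trans.
Qed.

Lemma Re_lipschitz1 (x y : C) :
  `|complex.Re x - complex.Re y| <= modulus (x - y).
Proof. by rewrite -raddfB; exact: Re_le_modulus. Qed.

Lemma Im_lipschitz1 (x y : C) :
  `|complex.Im x - complex.Im y| <= modulus (x - y).
Proof. by rewrite -raddfB; exact: Im_le_modulus. Qed.

Lemma modulus_lipschitz1 (x y : C) : `|modulus x - modulus y| <= modulus (x - y).
Proof.
have := modulusD (x - y) y; have := modulusD (y - x) x.
by rewrite !subrK [modulus (y - x)]modulusBC ler_norml; lra.
Qed.

Lemma continuous_Re : continuous (@complex.Re R : C^o -> R).
Proof. exact: continuous_lipschitz1 Re_lipschitz1. Qed.

Lemma continuous_Im : continuous (@complex.Im R : C^o -> R).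
Proof. exact: continuous_lipschitz1 Im_lipschitz1. Qed.

Lemma continuous_modulus : continuous (@modulus R : C^o -> R).
Proof. exact: continuous_lipschitz1 modulus_lipschitz1. Qed.

Lemma cvg_ReIm {T : Type} (F : set_system T) {FF : Filter F} (f : T -> C^o) (a b : R) :
  (fun x => complex.Re (f x)) @ F --> a ->
  (fun x => complex.Im (f x)) @ F --> b -> f @ F --> ((a +i* b)%C : C^o).
Proof.
move=> /cvgrPdist_lt fa /cvgrPdist_lt fb; apply/cvg_modulusP => e e0.
have e20 : 0 < e / 2 by lra.
near=> x; apply: le_lt_trans (modulus_le_ReIm _) _.
rewrite !raddfB /= [ltRHS]splitr ltrD//; near: x; [exact: fa|exact: fb].
Unshelve. all: by end_near. Qed.

(** The approximations make [u] a Cauchy family; its limit is produced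
separately for the real and the imaginary part, from the completeness of the
real numbers. *)
Lemma is_cvg_approx {T : Type} (F : set_system T) {FF : ProperFilter F} (u : T -> C^o) :
  (forall e : R, 0 < e -> exists2 v : T -> C^o, cvg (v @ F) &
     \forall x \near F, modulus (u x - v x) <= e) ->
  cvg (u @ F).
Proof.
move=> h.
have hR (g : C -> R) : (forall x y, `|g x - g y| <= modulus (x - y)) -> cvg ((g \o u) @ F).
  move=> gle; apply/cauchy_cvgP/cauchyP => e e0 /=.
  have e40 : 0 < e / 4 by lra.
  have [v /cvg_ex[l /cvg_modulusP vl] uv] := h _ e40.
  exists (g l); rewrite nbhs_simpl /=.
  near=> x; rewrite /ball /=.
  apply: le_lt_trans (gle _ _) _.
  have -> : l - u x = (l - v x) - (u x - v x) by ring.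
  apply: le_lt_trans (modulusD _ _) _; rewrite modulusN.
  have h1 : modulus (l - v x) < e / 4 by near: x; exact: vl.
  have h2 : modulus (u x - v x) <= e / 4 by near: x.
  lra.
have /cvg_ex[a ha] := hR _ Re_lipschitz1.
have /cvg_ex[b hb] := hR _ Im_lipschitz1.
by apply/cvg_ex; exists ((a +i* b)%C : C^o); exact: cvg_ReIm.
Unshelve. all: by end_near. Qed.

Lemma cvg_near {T : Type} (F : set_system T) {FF : Filter F} (u v : T -> C^o) (l : C^o) :
  (\forall n \near F, u n = v n) -> v @ F --> l -> u @ F --> l.
Proof.
move=> uv vl; apply: cvg_trans vl; apply: near_eq_cvg.
by apply: filterS uv => n ->.
Qed.

Lemma is_cvg_near {T : Type} (F : set_system T) {FF : Filter F} (u v : T -> C^o) :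
  (\forall n \near F, u n = v n) -> cvg (v @ F) -> cvg (u @ F).
Proof.
by move=> uv /cvg_ex[l vl]; apply/cvg_ex; exists l; exact: cvg_near vl.
Qed.

Lemma is_cvg_sum {T : Type} (F : set_system T) {FF : Filter F} (I : Type)
    (r : seq I) (u : I -> T -> C^o) :
  (forall i, cvg (u i n @[n --> F])) -> cvg ((\sum_(i <- r) u i n : C^o) @[n --> F]).
Proof.
move=> h; elim: r => [|i r IH].
  by under eq_fun do rewrite big_nil; exact: is_cvg_cst.
under eq_fun do rewrite big_cons.
exact: (@is_cvgD _ C^o _ F FF _ _ (h i) IH).
Qed.

Lemma modulus_lim_le {T : Type} (F : set_system T) {FF : ProperFilter F} (u : T -> C^o) (M : R) :
  cvg (u @ F) -> (forall n, modulus (u n) <= M) -> modulus (lim (u @ F)) <= M.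
Proof.
move=> cu uM; apply/ler_addgt0Pr => e e0.
have /cvg_modulusP/(_ _ e0)/filter_ex[n hn] := cu.
have := modulusD (lim (u @ F) - u n) (u n); rewrite subrK.
by have := uM n; lra.
Qed.

End topology_of_complex.

(** * Power series dominated by a geometric series *)

Section power_series.
Context {R : realType}.
Local Notation C := R[i].
Implicit Types (a : nat -> C) (w y : C) (A B rho : R).

Lemma exists_geometric_le A rho (e : R) : 0 <= rho < 1 -> 0 < e ->
  exists K, forall n, (K <= n)%N -> A * rho ^+ n <= e.
Proof.
move=> /andP[r0 r1] e0.
have /cvgrPdist_lt/(_ _ e0)[K _ hK] := @cvg_geometric R A rho ltac:(by rewrite ger0_norm).
exists K => n /hK /=; rewrite sub0r normrN => /ltW; apply: le_trans.
exact: ler_norm.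
Qed.

Lemma modulus_geometric0 A rho (x : C) : 0 <= rho < 1 ->
  (forall K, modulus x <= A * rho ^+ K) -> x = 0.
Proof.
move=> rho01 h; apply/eqP; rewrite -modulus_eq0 eq_le modulus_ge0 andbT.
apply/ler_addgt0Pr => e e0; rewrite add0r.
have [K /(_ K (leqnn K))] := exists_geometric_le A rho01 e0.
exact: le_trans.
Qed.

Definition psum a w : C := limn (series (fun k => a k * w ^+ k : C^o)).

Section dominated.
Variables (a : nat -> C) (A B : R).
Hypotheses (A0 : 0 <= A) (B0 : 0 <= B) (aB : forall k, modulus (a k) <= A * B ^+ k).
Variable w : C.
Hypothesis w1 : B * modulus w < 1.
Let rho := B * modulus w.

Let rho01 : 0 <= rho < 1.
Proof. by rewrite w1 andbT mulr_ge0 ?modulus_ge0. Qed.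

Let term_le k : modulus (a k * w ^+ k) <= A * rho ^+ k.
Proof.
rewrite modulusM modulusX exprMn mulrA ler_wpM2r ?exprn_ge0 ?modulus_ge0//.
Qed.

Let partial_le K m :
  modulus (\sum_(0 <= k < K + m) a k * w ^+ k - \sum_(0 <= k < K) a k * w ^+ k)
    <= A * rho ^+ K / (1 - rho).
Proof.
have h01 := rho01.
rewrite -[leRHS]mulr1.
apply: (@le_trans _ _ (A * rho ^+ K / (1 - rho) * (1 - rho ^+ m))); last first.
  rewrite ler_wpM2l//; first by rewrite divr_ge0 ?mulr_ge0 ?exprn_ge0//; lra.
  by rewrite gerBl exprn_ge0//; lra.
elim: m => [|m IH]; first by rewrite addn0 subrr modulus0 expr0 subrr mulr0.
rewrite addnS big_nat_recr//= addrAC; apply: le_trans (modulusD _ _) _.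
apply: le_trans (lerD IH (term_le _)) _.
rewrite le_eqVlt; apply/orP; left; apply/eqP; rewrite exprD exprS; field.
lra.
Qed.

Lemma psum_tail K :
  modulus (psum a w - \sum_(0 <= k < K) a k * w ^+ k) <= A * rho ^+ K / (1 - rho).
Proof.
have h01 := rho01.
have cv : cvgn (series (fun k => a k * w ^+ k : C^o)).
  apply: is_cvg_approx => e e0.
  have [N hN] := exists_geometric_le (A / (1 - rho)) rho01 e0.
  exists (fun=> \sum_(0 <= k < N) a k * w ^+ k); first exact: is_cvg_cst.
  exists N => // n /= Nn; rewrite /series /= -(subnKC Nn).
  by apply: le_trans (partial_le _ _) _; rewrite mulrAC hN.
apply/ler_addgt0Pr => e e0.
have [N _ hN] := (proj1 (cvg_modulusP _ _) cv) e e0.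
have {hN} := hN (K + N)%N; rewrite /= leq_addl => /(_ isT) h.
rewrite -(subrK (series (fun k => a k * w ^+ k : C^o) (K + N)%N) (psum a w)) -addrA.
apply: le_trans (modulusD _ _) _.
by rewrite [leRHS]addrC lerD ?(ltW h)// partial_le.
Qed.

Lemma modulus_psum_le : modulus (psum a w) <= A / (1 - rho).
Proof. by have := psum_tail 0; rewrite big_nil subr0 expr0 mulr1. Qed.

End dominated.

(** Both sides are approximated by the same partial sums with geometric error. *)
Lemma psum_rec a A B w : 0 <= A -> 0 <= B ->
  (forall k, modulus (a k) <= A * B ^+ k) -> B * modulus w < 1 ->
  psum a w = a 0%N + w * psum (fun k => a k.+1) w.
Proof.
move=> A0 B0 aB w1; have w0 := modulus_ge0 w.
have r0 : 0 <= B * modulus w by exact: mulr_ge0.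
have aB' k : modulus (a k.+1) <= A * B * B ^+ k by rewrite -mulrA -exprS.
apply/eqP; rewrite -subr_eq0; apply/eqP.
apply: (@modulus_geometric0 (A * (B * modulus w) / (1 - B * modulus w) * 2) (B * modulus w)).
  by rewrite r0.
move=> K.
have h1 := psum_tail A0 B0 aB w1 K.+1.
have h2 := psum_tail (mulr_ge0 A0 B0) B0 aB' w1 K.
rewrite big_nat_recl//= expr0 mulr1 in h1.
have -> : psum a w - (a 0%N + w * psum (fun k => a k.+1) w) =
  (psum a w - (a 0%N + \sum_(0 <= i < K) a i.+1 * w ^+ i.+1)) -
  w * (psum (fun k => a k.+1) w - \sum_(0 <= k < K) a k.+1 * w ^+ k).
  rewrite mulrBr mulr_sumr; under [X in _ - (_ - X)]eq_bigr do rewrite mulrCA -exprS.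
  by ring.
apply: le_trans (modulusD _ _) _; rewrite modulusN modulusM.
apply: le_trans (lerD h1 (ler_wpM2l w0 h2)) _.
rewrite le_eqVlt; apply/orP; left; apply/eqP; rewrite exprS; field; lra.
Qed.

(** Coefficients of the divided difference of [psum a] at [w]. *)
Definition psum_quotient a w : nat -> C := fun i => psum (fun k => a (i.+1 + k)%N) w.

Lemma psum_quotient_le a A B w k : 0 <= A -> 0 <= B ->
  (forall k, modulus (a k) <= A * B ^+ k) -> B * modulus w < 1 ->
  modulus (psum_quotient a w k) <= A * B / (1 - B * modulus w) * B ^+ k.
Proof.
move=> A0 B0 aB w1.
have aB' i : modulus (a (k.+1 + i)%N) <= A * B ^+ k.+1 * B ^+ i by rewrite -mulrA -exprD.
have := modulus_psum_le (mulr_ge0 A0 (exprn_ge0 k.+1 B0)) B0 aB' w1.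
by rewrite exprS mulrA mulrAC.
Qed.

(** Synthetic division by [y - w].  The tails [D i] of the series at [w] satisfy
[D i = a i + w * D i.+1], so the partial sums of the right-hand side telescope
and no double series has to be rearranged.  As the quotient is again dominated
with the same ratio [B], this single identity yields boundedness of the
difference quotient, hence continuity, and then its continuity, hence
differentiability. *)
Lemma psum_slope a A B w y : 0 <= A -> 0 <= B ->
  (forall k, modulus (a k) <= A * B ^+ k) -> B * modulus w < 1 ->
  B * modulus y < 1 ->
  psum a y - psum a w = (y - w) * psum (psum_quotient a w) y.
Proof.
move=> A0 B0 aB w1 y1.
have y0 := modulus_ge0 y; have w0 := modulus_ge0 w.
have r0 : 0 <= B * modulus y by exact: mulr_ge0.
pose D i := psum (fun k => a (i + k)%N) w.
have aB' i k : modulus (a (i + k)%N) <= A * B ^+ i * B ^+ k by rewrite -mulrA -exprD.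
have AB i : 0 <= A * B ^+ i by rewrite mulr_ge0 ?exprn_ge0.
have Drec i : D i = a i + w * D i.+1.
  rewrite /D (psum_rec (AB i) B0 (aB' i) w1) addn0; congr (_ + _ * psum _ _).
  by apply/funext => k; rewrite addSnnS.
have D0 : D 0%N = psum a w by [].
have part K : (y - w) * \sum_(0 <= i < K) psum_quotient a w i * y ^+ i =
    \sum_(0 <= i < K) a i * y ^+ i - D 0%N + D K * y ^+ K.
  elim: K => [|K IH]; first by rewrite !big_nil; ring.
  rewrite !big_nat_recr//= mulrDr IH (_ : psum_quotient a w K = D K.+1)//.
  by rewrite [D K]Drec exprS; ring.
set x := psum a w in D0 *; apply/eqP; rewrite -subr_eq0; apply/eqP.
set c := A * B / (1 - B * modulus w).
have c0 : 0 <= c by rewrite divr_ge0 ?mulr_ge0//; lra.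
have hq k : modulus (psum_quotient a w k) <= c * B ^+ k by exact: psum_quotient_le.
apply: (@modulus_geometric0 (A / (1 - B * modulus y) +
   modulus (y - w) * (c / (1 - B * modulus y)) + A / (1 - B * modulus w)) (B * modulus y)).
  by rewrite r0.
move=> K.
have h1 := psum_tail A0 B0 aB y1 K.
have h2 := psum_tail c0 B0 hq y1 K.
have h3 := modulus_psum_le (AB K) B0 (aB' K) w1.
have -> : psum a y - x - (y - w) * psum (psum_quotient a w) y =
   (psum a y - \sum_(0 <= k < K) a k * y ^+ k) -
   (y - w) * (psum (psum_quotient a w) y - \sum_(0 <= i < K) psum_quotient a w i * y ^+ i)
   + - (D K * y ^+ K).
  by rewrite [(y - w) * (_ - \sum_(_ <= _ < _) _)]mulrBr part D0; ring.
apply: le_trans (modulusD _ _) _; rewrite modulusN modulusM modulusX.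
apply: le_trans (lerD (le_trans (modulusD _ _) (lexx _)) (lexx _)) _.
rewrite modulusN modulusM !mulrDl.
apply: lerD; first (apply: lerD).
- by rewrite mulrAC.
- by rewrite -mulrA ler_wpM2l ?modulus_ge0// mulrAC.
- apply: le_trans (ler_wpM2r (exprn_ge0 _ y0) h3) _.
  by rewrite exprMn le_eqVlt; apply/orP; left; apply/eqP; field; lra.
Qed.

(** The midpoint between [B * modulus w] and [1] leaves room on both sides. *)
Lemma near_modulus_lt (w : C^o) B : 0 <= B -> B * modulus w < 1 ->
  exists2 e : R, 0 < e & forall y, modulus (w - y) < e -> B * modulus y < (1 + B * modulus w) / 2.
Proof.
move=> B0 w1; exists ((1 - B * modulus w) / (2 * (B + 1))).
  by rewrite divr_gt0//; lra.
move=> y; rewrite ltr_pdivlMr; last lra.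
have := modulusD w (y - w); rewrite addrC subrK [modulus (w - y)]modulusBC => h1 h2.
have h3 := modulus_ge0 (y - w).
have := ler_wpM2l B0 h1; lra.
Qed.

Lemma continuous_psum a A B w : 0 <= A -> 0 <= B ->
  (forall k, modulus (a k) <= A * B ^+ k) -> B * modulus w < 1 ->
  {for w, continuous (psum a : C^o -> C^o)}.
Proof.
move=> A0 B0 aB w1.
set c := A * B / (1 - B * modulus w).
have c0 : 0 <= c by rewrite divr_ge0 ?mulr_ge0//; lra.
have hq k : modulus (psum_quotient a w k) <= c * B ^+ k by exact: psum_quotient_le.
have [e0 e00 he0] := near_modulus_lt B0 w1.
set L := c / ((1 - B * modulus w) / 2).
have L0 : 0 <= L by rewrite divr_ge0//; lra.
apply/(@cvg_modulusP _ C^o (nbhs (w : C^o)) (nbhs_filter (w : C^o)) (psum a)) => e e_gt0.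
apply/nbhs_modulusP; exists (Num.min e0 (e / (L + 1))).
  by rewrite lt_min e00 divr_gt0//; lra.
move=> y; rewrite lt_min => /andP[/he0 yB]; rewrite ltr_pdivlMr; last lra.
move=> ye; have y1 : B * modulus y < 1 by lra.
rewrite modulusBC (psum_slope A0 B0 aB w1 y1) modulusM modulusBC.
have h := modulus_psum_le c0 B0 hq y1.
have hL : c / (1 - B * modulus y) <= L.
  by rewrite ler_wpM2l// lef_pV2 ?posrE//; lra.
have m0 := modulus_ge0 (w - y).
have := ler_wpM2l m0 (le_trans h hL).
lra.
Qed.

(** Caratheodory's criterion for differentiability. *)
Lemma derivable_slope (f q : C^o -> C^o) (w : C^o) :
  {for w, continuous q} ->
  (exists2 e : R, 0 < e & forall y, modulus (w - y) < e -> f y - f w = (y - w) * q y) ->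
  derivable f w 1.
Proof.
move=> qw [e0 e00 slope]; apply/cvg_ex; exists (q w).
apply/(@cvg_modulusP _ C^o (dnbhs (0 : C^o)) _) => e e_gt0.
have /nbhs_modulusP[d d0 hd] := proj1 (@cvg_modulusP _ C^o _ (nbhs_filter w) q (q w)) qw e e_gt0.
apply/nbhs_modulusP; exists (Num.min e0 d); first by rewrite lt_min e00.
move=> h; rewrite sub0r modulusN lt_min => /andP[he hd'] h0 /=.
have hw : modulus (w - (h *: 1 + w)) = modulus h.
  by rewrite -[in RHS]modulusN; congr modulus; rewrite /GRing.scale /=; ring.
rewrite slope ?hw//.
rewrite addrK.
have -> : h^-1 *: (h *: 1 * q (h *: 1 + w)) = q (h *: 1 + w).
  by rewrite /GRing.scale /=; field.
by apply: hd; rewrite hw.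
Qed.

Lemma derivable_psum a A B w : 0 <= A -> 0 <= B ->
  (forall k, modulus (a k) <= A * B ^+ k) -> B * modulus w < 1 ->
  derivable (psum a : C^o -> C^o) w 1.
Proof.
move=> A0 B0 aB w1.
set c := A * B / (1 - B * modulus w).
have c0 : 0 <= c by rewrite divr_ge0 ?mulr_ge0//; lra.
have hq k : modulus (psum_quotient a w k) <= c * B ^+ k by exact: psum_quotient_le.
apply: (@derivable_slope _ (psum (psum_quotient a w))).
  exact: continuous_psum c0 B0 hq w1.
have [e e0 he] := near_modulus_lt B0 w1.
exists e => // y /he yB; have y1 : B * modulus y < 1 by lra.
exact: psum_slope A0 B0 aB w1 y1.
Qed.

(** In the coordinate [w = 1 / z] the function is the power series itself, so
nothing special happens at infinity. *)
Lemma analytic_psum_inv (c : nat -> C) (B : R) : 0 < B ->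
  (forall k, modulus (c k) <= 1 * B ^+ k) ->
  analytic_outside B (fun z => psum c z^-1).
Proof.
move=> B0 cB; have B0' := ltW B0; split=> [z Bz|].
  have z0 : z != 0 by rewrite -modulus_gt0; exact: lt_trans Bz.
  have Bz1 y : B < modulus y -> B * modulus y^-1 < 1.
    by move=> By; rewrite modulusV ltr_pdivrMr ?mul1r//; exact: lt_trans By.
  set q := psum_quotient c z^-1; set D := 1 * B / (1 - B * modulus z^-1).
  have D0 : 0 <= D by have := Bz1 z Bz; rewrite /D => h; rewrite divr_ge0 ?mul1r//; lra.
  have qB k : modulus (q k) <= D * B ^+ k by apply: psum_quotient_le => //; exact: Bz1.
  apply: (@derivable_slope _ (fun y => - (y^-1 * z^-1) * psum q y^-1)).
    have cV : (y^-1 : C^o) @[y --> (z : C^o)] --> (z^-1 : C^o) by exact: (@inv_continuous C z z0).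
    have cq : (psum q y^-1 : C^o) @[y --> (z : C^o)] --> (psum q z^-1 : C^o).
      exact: (cvg_comp _ _ cV (continuous_psum D0 B0' qB (Bz1 z Bz))).
    exact: (cvgM (cvgN (cvgM cV (cvg_cst _))) cq).
  exists (modulus z - B); first by rewrite subr_gt0.
  move=> y yz; have By : B < modulus y.
    by have := modulusD y (z - y); rewrite addrC subrK; lra.
  have y0 : y != 0 by rewrite -modulus_gt0; exact: lt_trans By.
  rewrite (psum_slope ler01 B0' cB (Bz1 z Bz) (Bz1 y By)) -/q mulrA; congr (_ * _).
  by field; rewrite y0 z0.
exists (psum c 0).
have -> : (fun w : C => if w == 0 then psum c 0 else psum c (w^-1)^-1) = psum c.
  by apply/funext => w; rewrite invrK; case: eqP => [->|].
apply/nbhs_modulusP; exists B^-1; first by rewrite invr_gt0.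
move=> w; rewrite sub0r modulusN => wB; apply: derivable_psum ler01 B0' cB _.
by rewrite mulrC -ltr_pdivlMr// mul1r.
Qed.

End power_series.

(** * Limits along a set of indices *)

Section limits_through.
Context {R : realType}.
Local Notation C := R[i].
Variable N : set nat.

Lemma through_proper : infinite_set N -> ProperFilter (through N).
Proof.
move=> infN; apply: Build_ProperFilter_ex => P [K _ hK].
apply: contrapT => nP; apply: infN.
apply: (@sub_finite_set _ _ `I_K); last exact: finite_II.
move=> n Nn /=; rewrite ltnNge; apply/negP => Kn; apply: nP.
by exists n; exact: hK.
Qed.

Lemma near_through K (P : nat -> Prop) :
  (forall n, (K <= n)%N -> P n) -> \forall n \near through N, P n.
Proof. by move=> h; exists K => // n /= Kn _; exact: h. Qed.

(** Each fixed pair of offsets is eventually an entry of a centered window, and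
each window has finitely many entries. *)
Lemma right_limitP (A : nat -> nat -> C) :
  approaches_right_limit A N <->
  forall a b : int, cvg ((A (absz (n%:Z + a)) (absz (n%:Z + b)) : C^o) @[n --> through N]).
Proof.
split=> [[X AX] a b|h].
  pose m := (absz a + absz b)%N.
  have am : (absz (m%:Z + a)%R < m.*2.+1)%N by rewrite /m; lia.
  have bm : (absz (m%:Z + b)%R < m.*2.+1)%N by rewrite /m; lia.
  apply/cvg_ex; exists (centered_submx0 X m (Ordinal am) (Ordinal bm) : C^o).
  apply: (@cvg_near _ _ _ _ _ (fun n => centered_submx A n m (Ordinal am) (Ordinal bm) : C^o)).
    apply: (@near_through m) => n mn; rewrite mxE /=; congr A; lia.
  apply: (cvg_comp (fun n => centered_submx A n m) (fun M => M (Ordinal am) (Ordinal bm)) (AX m)).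
  exact: (@coord_continuous C).
pose X (a b : int) : C := lim ((A (absz (n%:Z + a)) (absz (n%:Z + b)) : C^o) @[n --> through N]).
exists X => m U [P hP sub].
apply: (filterS (P := [set n | forall i k, P i k (centered_submx A n m i k)])).
  by move=> n hn; exact: sub.
have Fl : Filter (through N) by exact: within_filter.
apply: (@filter_forall _ _ (fun i => [set n | forall k, P i k (centered_submx A n m i k)]) _ Fl) => i.
apply: (@filter_forall _ _ (fun k => [set n | P i k (centered_submx A n m i k)]) _ Fl) => k.
suff : (centered_submx A n m i k : C^o) @[n --> through N] --> (centered_submx0 X m i k : C^o).
  by move=> /(_ _ (hP i k)).
have := h (i%:Z - m%:Z) (k%:Z - m%:Z); rewrite mxE => hik.
apply: (cvg_near _ hik); apply: (@near_through m) => n mn; rewrite mxE; congr A; lia.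
Qed.

End limits_through.

Section uniform_convergence.
Context {R : realType}.
Local Notation C := R[i].

Lemma cvg_uniform_modulusP {T : Type} (F : set_system T) {FF : Filter F}
    (A : set C) (u : T -> C -> C^o) (f : C -> C^o) :
  {uniform A, u @ F --> f} <->
  (forall e : R, 0 < e -> \forall n \near F, forall z, A z -> modulus (f z - u n z) < e).
Proof.
split=> [uf e e0|h].
  have e0' : 0 < (e%:C%C : C) by rewrite ltcR.
  have := uf [set g | forall z, A z -> modulus (f z - g z) < e].
  apply; apply/uniform_nbhs; exists [set xy : C^o * C^o | ball xy.1 e%:C%C xy.2].
  split; first by have := @entourage_ball _ C^o (PosNum e0').
  by move=> g /= hg z /hg; rewrite /ball /= modulusE ltcR.
move=> P /uniform_nbhs[E [+ EP]]; rewrite -entourage_ballE => -[e /= e0 eE].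
have ee : e = (complex.Re e)%:C%C by rewrite RRe_real ?gtr0_real.
have := h (complex.Re e); rewrite -ltcR -ee => /(_ e0); apply: filterS => n hn.
apply: EP => z Az; apply: eE; rewrite /ball /= modulusE ee ltcR; exact: hn.
Qed.

Lemma sum_near0 {F : set_system nat} {FF : Filter F} (u : nat -> nat -> C)
    (c : nat -> C) (s : R) K : 0 <= s ->
  (forall k, (u n k : C^o) @[n --> F] --> (c k : C^o)) ->
  forall e : R, 0 < e ->
  \forall n \near F, \sum_(0 <= k < K) modulus (c k - u n k) * s ^+ k < e.
Proof.
move=> s0 uc; elim: K => [|K IH] e e0.
  by apply: filterE => n; rewrite big_nil.
have e2 : 0 < e / 2 by lra.
have sK : 0 <= s ^+ K by exact: exprn_ge0.
have eK : 0 < e / 2 / (s ^+ K + 1) by rewrite divr_gt0//; lra.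
have /cvg_modulusP/(_ _ eK) hK := uc K.
apply: filterS2 (IH _ e2) hK => n h1; rewrite ltr_pdivlMr; last lra.
rewrite big_nat_recr//= => h2.
have := modulus_ge0 (c K - u n K); lra.
Qed.

(** The tails beyond some [K] are small uniformly in [n] and [w]; below [K] only
finitely many coefficients have to be close to their limits. *)
Lemma psum_uniform {F : set_system nat} {FF : Filter F} (u : nat -> nat -> C)
    (c : nat -> C) (A B s : R) : 0 <= A -> 0 <= B -> 0 <= s -> B * s < 1 ->
  (forall n k, modulus (u n k) <= A * B ^+ k) ->
  (forall k, modulus (c k) <= A * B ^+ k) ->
  (forall k, (u n k : C^o) @[n --> F] --> (c k : C^o)) ->
  forall e : R, 0 < e ->
  \forall n \near F, forall w, modulus w <= s -> modulus (psum c w - psum (u n) w) < e.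
Proof.
move=> A0 B0 s0 Bs uB cB uc e e0.
have Bs0 : 0 <= B * s by exact: mulr_ge0.
have e4 : 0 < e / 4 by lra.
have [K hK] := @exists_geometric_le R (A / (1 - B * s)) (B * s) (e / 4) ltac:(by rewrite Bs0) e4.
have {hK} := hK K (leqnn K) => hK.
apply: filterS (sum_near0 K s0 uc e4) => n hn w ws.
have w0 := modulus_ge0 w.
have Bw : B * modulus w <= B * s by rewrite ler_wpM2l.
have Bw0 : 0 <= B * modulus w by exact: mulr_ge0.
have Bw1 : B * modulus w < 1 by lra.
have tailK : A * (B * modulus w) ^+ K / (1 - B * modulus w) <= e / 4.
  apply: le_trans hK; rewrite mulrAC ler_pM ?exprn_ge0 ?divr_ge0 ?lerXn2r ?nnegrE//; first lra.
  by rewrite ler_wpM2l// lef_pV2 ?posrE//; lra.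
have h1 := le_trans (psum_tail A0 B0 cB Bw1 K) tailK.
have h2 := le_trans (psum_tail A0 B0 (uB n) Bw1 K) tailK.
have h3 : modulus (\sum_(0 <= k < K) c k * w ^+ k - \sum_(0 <= k < K) u n k * w ^+ k) <= e / 4.
  apply: le_trans (ltW hn); rewrite -sumrB; apply: le_trans (modulus_sum _ _ _) _.
  rewrite ler_sum// => k _; rewrite -mulrBl modulusM modulusX ler_wpM2l ?modulus_ge0//.
  by rewrite lerXn2r ?nnegrE.
set S := \sum_(_ <= _ < _) _ in h1 h3; set S' := \sum_(_ <= _ < _) _ in h2 h3.
have -> : psum c w - psum (u n) w = (psum c w - S) + (S - S') - (psum (u n) w - S') by ring.
apply: le_lt_trans (modulusD _ _) _; rewrite modulusN.
have := modulusD (psum c w - S) (S - S'); lra.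
Qed.

End uniform_convergence.

Lemma limn_einf_gt0 {R : realType} (u : nat -> R) : (0 < limn_einf (EFin \o u))%E ->
  exists2 beta : R, 0 < beta & \forall n \near \oo, beta <= u n.
Proof.
rewrite limn_einf_lim (cvg_lim _ (@cvg_einfs_sup _ (EFin \o u)))// => h.
have [_ [n _ <-]] := ereal_sup_gt h.
rewrite /einfs /= => h0.
have lb m : (n <= m)%N -> (ereal_inf (sdrop (EFin \o u) n) <= (u m)%:E)%E.
  by move=> nm; apply: ereal_inf_lbound; exists m.
case: (ereal_inf _) h0 lb => [b||] //= h0 lb; last first.
  by have := lb n (leqnn n).
exists b; first by rewrite -lte_fin.
by exists n => // m /= nm; rewrite -lee_fin; exact: lb.
Qed.

(** * Orthonormal polynomials and the truncated multiplication operator *)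

(** Apart from sesquilinearity and orthonormality, the measure enters only
through [ip_X]: multiplication by the variable has norm at most [B] on
polynomials. *)
Section orthonormal_system.
Context {R : realType}.
Local Notation C := R[i].
Implicit Types (q s : {poly C}) (z : C).
Variables (p : nat -> {poly C}) (ip : {poly C} -> {poly C} -> C) (B : R).
Hypotheses (size_p : forall n, size (p n) = n.+1)
  (lead_p : forall n, 0 < lead_coef (p n))
  (ip_linear : forall (c : C) q s t, ip (c *: q + s) t = c * ip q t + ip s t)
  (ip_conj : forall q s, ip q s = (ip s q)^*)
  (ip_ortho : forall n m, ip (p n) (p m) = (n == m)%:R)
  (B_gt0 : 0 < B)
  (ip_X : forall q, complex.Re (ip ('X * q) ('X * q)) <= B ^+ 2 * complex.Re (ip q q)).

Let ip0l t : ip 0 t = 0.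
Proof. by have := ip_linear (-1) 0 0 t; rewrite scaler0 addr0 mulN1r addNr. Qed.

Let ipDl q s t : ip (q + s) t = ip q t + ip s t.
Proof. by rewrite -{1}[q]scale1r ip_linear mul1r. Qed.

Let ipZl c q t : ip (c *: q) t = c * ip q t.
Proof. by rewrite -[_ *: _]addr0 ip_linear ip0l addr0. Qed.

Let ip_suml n (c : nat -> C) (q : nat -> {poly C}) t :
  ip (\sum_(i < n) c i *: q i) t = \sum_(i < n) c i * ip (q i) t.
Proof.
elim: n => [|n IH]; first by rewrite !big_ord0 ip0l.
by rewrite !big_ord_recr /= ipDl ipZl IH.
Qed.

Let ip_coord n (c : nat -> C) j :
  ip (\sum_(i < n) c i *: p i) (p j) = if (j < n)%N then c j else 0.
Proof.
rewrite ip_suml; under eq_bigr do rewrite ip_ortho.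
case: ifP => jn.
  rewrite (bigD1 (Ordinal jn)) //= eqxx mulr1 big1 ?addr0// => i.
  by rewrite -val_eqE /= => /negPf ->; rewrite mulr0.
rewrite big1 // => i _; rewrite (_ : _ == _ = false) ?mulr0//.
by apply/eqP => ij; rewrite -ij ltn_ord in jn.
Qed.

(** Induction on [n]: subtracting the multiple of [p n] that cancels the leading
term leaves a polynomial of lower degree. *)
Lemma orthonormal_expansion n q : (size q <= n)%N ->
  q = \sum_(i < n) ip q (p i) *: p i.
Proof.
elim: n q => [|n IH] q qn.
  by rewrite big_ord0; apply/eqP; rewrite -size_poly_eq0 -leqn0.
have lc0 : lead_coef (p n) != 0 by rewrite gt_eqF.
set c := q`_n / lead_coef (p n).
have sq' : (size (q - c *: p n)%R <= n)%N.
  apply/leq_sizeP => j; rewrite leq_eqVlt => /orP[/eqP <-|nj].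
    rewrite coefB coefZ /c; have -> : lead_coef (p n) = (p n)`_n by rewrite lead_coefE size_p.
    by rewrite divfK ?subrr//; rewrite lead_coefE size_p in lc0.
  by rewrite coefB coefZ !nth_default ?mulr0 ?subr0// ?size_p// (leq_trans qn).
have {}IH := IH _ sq'; set q' := q - c *: p n in IH sq'.
have qE : q = c *: p n + q' by rewrite addrC subrK.
have q'n : ip q' (p n) = 0 by rewrite IH (ip_coord n (fun i => ip q' (p i))) ltnn.
have cE : ip q (p n) = c by rewrite qE ip_linear ip_ortho eqxx mulr1 q'n addr0.
rewrite big_ord_recr /= cE [LHS]qE [LHS]addrC; congr (_ + _).
rewrite [LHS]IH; apply: eq_bigr => i _.
by rewrite [in RHS]qE ip_linear ip_ortho (gtn_eqF (ltn_ord i)) mulr0 add0r.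
Qed.

Lemma ip_lower_degree n q : (size q <= n)%N -> ip q (p n) = 0.
Proof.
move=> /orthonormal_expansion ->.
by rewrite (ip_coord n (fun i => ip q (p i))) ltnn.
Qed.

Let nrm q := complex.Re (ip q q).

Let parseval_sum n (c : nat -> C) :
  nrm (\sum_(i < n) c i *: p i) = \sum_(i < n) modulus (c i) ^+ 2.
Proof.
rewrite /nrm {1}ip_suml raddf_sum; apply: eq_bigr => i _.
by rewrite ip_conj ip_coord ltn_ord -modulus_sqr.
Qed.

Lemma parseval n q : (size q <= n)%N ->
  complex.Re (ip q q) = \sum_(i < n) modulus (ip q (p i)) ^+ 2.
Proof.
move=> qn; rewrite -/(nrm q) {1}(orthonormal_expansion qn).
exact: (parseval_sum n (fun i => ip q (p i))).
Qed.

(** The Bergman shift matrix, but with rows and columns indexed from [0], like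
the polynomials. *)
Definition hess i k := ip ('X * p k) (p i).

Lemma hess_lower i k : (k.+1 < i)%N -> hess i k = 0.
Proof.
move=> ki; apply: ip_lower_degree; apply: leq_trans (size_polyMleq _ _) _.
by rewrite size_polyX size_p.
Qed.

Let size_XM q n : (size q <= n)%N -> (size ('X * q)%R <= n.+1)%N.
Proof. by move=> qn; apply: leq_trans (size_polyMleq _ _) _; rewrite size_polyX. Qed.

Lemma hess_column k : 'X * p k = \sum_(i < k.+2) hess i k *: p i.
Proof. by apply: orthonormal_expansion; apply: size_XM; rewrite size_p. Qed.

Lemma hess_column_eval z k : z * (p k).[z] = \sum_(i < k.+2) hess i k * (p i).[z].
Proof.
have := congr1 (horner^~ z) (hess_column k).
rewrite hornerM hornerX => ->; rewrite horner_sum; apply: eq_bigr => i _.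
by rewrite hornerZ.
Qed.

Let nrm_p n : nrm (p n) = 1.
Proof. by rewrite /nrm ip_ortho eqxx. Qed.

Let le_of_sqr (x y : R) : 0 <= y -> x ^+ 2 <= y ^+ 2 -> x <= y.
Proof. by move=> y0 h; rewrite leNgt; apply/negP => yx; nra. Qed.

(** A column of the matrix lists the coordinates of [z * p k], whose norm is at
most [B]. *)
Lemma hess_le i k : modulus (hess i k) <= B.
Proof.
have [ik|ki] := leqP i k.+1; last by rewrite hess_lower// modulus0 ltW.
apply: le_of_sqr; first exact: ltW.
have := ip_X (p k); rewrite -/(nrm (p k)) nrm_p mulr1; apply: le_trans.
rewrite (@parseval k.+2); last by apply: size_XM; rewrite size_p.
rewrite (bigD1 (Ordinal (ik : i < k.+2)%N)) //= lerDl sumr_ge0// => j _.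
by rewrite sqr_ge0.
Qed.

(** Comparison of the leading coefficients in the column identity. *)
Lemma hess_subdiag n : hess n.+1 n * lead_coef (p n.+1) = lead_coef (p n).
Proof.
have := congr1 (fun q : {poly C} => q`_n.+1) (hess_column n).
rewrite coefXM /= big_ord_recr /= coefD coefZ coef_sum big1 => [|i _].
  by rewrite add0r !lead_coefE !size_p.
by rewrite coefZ nth_default ?mulr0// size_p ltn_ord.
Qed.

(** Compression of multiplication by the variable to the polynomials of degree
less than [n]; its matrix is the upper left corner of order [n] of [hess]. *)
Definition trunc n q : {poly C} := \sum_(i < n) ip ('X * q) (p i) *: p i.

(** The coordinate of the part of [z * q] that [trunc n] cuts off. *)
Definition topcoef n q := ip ('X * q) (p n).

Lemma size_trunc n q : (size (trunc n q) <= n)%N.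
Proof.
apply: leq_trans (size_sum _ _ _) _; apply/bigmax_leqP => i _.
by apply: leq_trans (size_scale_leq _ _) _; rewrite size_p.
Qed.

Lemma truncE n q : (size q <= n)%N -> 'X * q = trunc n q + topcoef n q *: p n.
Proof. by move=> /size_XM/orthonormal_expansion {1}->; rewrite big_ord_recr. Qed.

Lemma pythagoras n q : (size q <= n)%N ->
  nrm ('X * q) = nrm (trunc n q) + modulus (topcoef n q) ^+ 2.
Proof.
move=> qn; rewrite /nrm (parseval (size_XM qn)) big_ord_recr; congr (_ + _).
by rewrite -/(nrm _) (parseval_sum n (fun i => ip ('X * q) (p i))).
Qed.

Lemma trunc_linear n : linear (trunc n).
Proof.
move=> c q s; rewrite /trunc scaler_sumr -big_split; apply: eq_bigr => i _ /=.
by rewrite mulrDr -scalerAr ip_linear scalerDl scalerA.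
Qed.

Lemma topcoef_linear n c q s : topcoef n (c *: q + s) = c * topcoef n q + topcoef n s.
Proof. by rewrite /topcoef mulrDr -scalerAr ip_linear. Qed.

Lemma size_iter_trunc n k q : (size q <= n)%N -> (size (iter k (trunc n) q) <= n)%N.
Proof. by case: k => // k _; exact: size_trunc. Qed.

Let nrm_ge0 n q : (size q <= n)%N -> 0 <= nrm q.
Proof. by move=> /parseval h; rewrite /nrm h sumr_ge0// => i _; rewrite sqr_ge0. Qed.

Lemma nrm_iter_trunc n k q : (size q <= n)%N ->
  nrm (iter k (trunc n) q) <= (B ^+ k) ^+ 2 * nrm q.
Proof.
move=> qn; elim: k => [|k IH]; first by rewrite expr0 expr1n mul1r.
have := pythagoras (size_iter_trunc k qn).
have := ip_X (iter k (trunc n) q); rewrite -!/(nrm _) iterS => h1 h2.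
apply: (@le_trans _ _ (nrm ('X * iter k (trunc n) q))).
  by rewrite h2 lerDl sqr_ge0.
by apply: le_trans h1 _; rewrite [B ^+ k.+1]exprS exprMn -[leRHS]mulrA ler_wpM2l// sqr_ge0.
Qed.

Lemma coord_iter_trunc_le n k q i : (size q <= n)%N -> nrm q <= 1 ->
  modulus (ip (iter k (trunc n) q) (p i)) <= B ^+ k.
Proof.
move=> qn q1; have B0 := ltW B_gt0.
apply: le_of_sqr; first exact: exprn_ge0.
have : nrm (iter k (trunc n) q) <= (B ^+ k) ^+ 2.
  apply: le_trans (nrm_iter_trunc k qn) _.
  by rewrite -[leRHS]mulr1 ler_wpM2l// sqr_ge0.
apply: le_trans; have sz := size_iter_trunc k qn.
have [ni|in_] := leqP n i.
  rewrite ip_lower_degree ?(leq_trans sz)// modulus0 expr0n.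
  exact: nrm_ge0 sz.
rewrite /nrm (parseval sz) (bigD1 (Ordinal in_)) //= lerDl sumr_ge0// => j _.
by rewrite sqr_ge0.
Qed.

Lemma topcoef_iter_trunc_le n k q : (size q <= n)%N -> nrm q <= 1 ->
  modulus (topcoef n (iter k (trunc n) q)) <= B ^+ k.+1.
Proof.
move=> qn q1; have B0 := ltW B_gt0.
apply: le_of_sqr; first exact: exprn_ge0.
have sz := size_iter_trunc k qn.
apply: (@le_trans _ _ (nrm ('X * iter k (trunc n) q))).
  by rewrite (pythagoras sz) lerDr (nrm_ge0 (size_trunc _ _)).
apply: le_trans (ip_X _) _; rewrite [B ^+ k.+1]exprS exprMn ler_wpM2l ?sqr_ge0//.
apply: le_trans (nrm_iter_trunc k qn) _.
by rewrite -[leRHS]mulr1 ler_wpM2l// sqr_ge0.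
Qed.

(** [q = topcoef n q / z * p n + trunc n q / z] as functions, iterated. *)
Lemma eval_telescope n q z K : z != 0 -> (size q <= n)%N ->
  q.[z] = (p n).[z] * \sum_(0 <= k < K) topcoef n (iter k (trunc n) q) * z^-1 ^+ k.+1
          + (iter K (trunc n) q).[z] * z^-1 ^+ K.
Proof.
move=> z0 qn; elim: K => [|K IH]; first by rewrite big_nil mulr0 add0r mulr1.
rewrite {1}IH big_nat_recr //= mulrDr -!addrA; congr (_ + _).
have := congr1 (horner^~ z) (truncE (size_iter_trunc K qn)).
rewrite hornerM hornerX hornerD hornerZ => h.
rewrite exprS -[in LHS](mulKf z0 (_).[z]) h; ring.
Qed.

Lemma eval_remainder_le n q z K : (size q <= n)%N -> nrm q <= 1 ->
  modulus ((iter K (trunc n) q).[z] * z^-1 ^+ K) <=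
  (\sum_(i < n) modulus (p i).[z]) * (B * modulus z^-1) ^+ K.
Proof.
move=> qn q1; rewrite modulusM modulusX exprMn mulrA.
rewrite ler_wpM2r ?exprn_ge0 ?modulus_ge0//.
rewrite (orthonormal_expansion (size_iter_trunc K qn)) horner_sum.
apply: le_trans (modulus_sum _ _ _) _; rewrite mulr_suml ler_sum// => i _.
rewrite hornerZ modulusM mulrC ler_wpM2l ?modulus_ge0//.
exact: coord_iter_trunc_le.
Qed.

Section outside.
Variable z : C.
Hypothesis Bz : B < modulus z.

Let z0 : z != 0.
Proof. by rewrite -modulus_gt0 (lt_trans B_gt0). Qed.

Let rho01 : 0 <= B * modulus z^-1 < 1.
Proof.
rewrite mulr_ge0 ?modulus_ge0 ?(ltW B_gt0)//= modulusV ltr_pdivrMr ?mul1r//.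
by rewrite modulus_gt0.
Qed.

(** At a zero of [p n.+1] the telescoped identity reduces to its remainder, which
tends to [0]; so [p n] would vanish there too, and so on down to the nonzero
constant [p 0]. *)
Lemma orthonormal_neq0 n : (p n).[z] != 0.
Proof.
elim: n => [|n IH].
  have /size_poly1P[c c0 ->] : size (p 0) == 1%N by rewrite size_p.
  by rewrite hornerC.
apply/eqP => pz; move/eqP : IH; apply.
apply: (modulus_geometric0 rho01) => K.
have sz : (size (p n) <= n.+1)%N by rewrite size_p.
rewrite (eval_telescope K z0 sz) pz mul0r add0r.
by apply: eval_remainder_le; rewrite ?size_p ?nrm_p.
Qed.

End outside.

(** Coefficients of [p n / p n.+1] in powers of [z^-1]; the constant one is [0]
because the ratio vanishes at infinity. *)
Definition ratio_coef n k : C :=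
  if k is k'.+1 then topcoef n.+1 (iter k' (trunc n.+1) (p n)) else 0.

Lemma ratio_coef_le n k : modulus (ratio_coef n k) <= 1 * B ^+ k.
Proof.
rewrite mul1r; case: k => [|k] /=; first by rewrite modulus0 exprn_ge0// ltW.
by apply: topcoef_iter_trunc_le; rewrite ?size_p ?nrm_p.
Qed.

Lemma ratio_psum z n : B < modulus z ->
  (p n).[z] / (p n.+1).[z] = psum (ratio_coef n) z^-1.
Proof.
move=> Bz; have B0 := ltW B_gt0.
have z0 : z != 0 by rewrite -modulus_gt0 (lt_trans B_gt0).
have rho1 : B * modulus z^-1 < 1.
  by rewrite modulusV ltr_pdivrMr ?mul1r// modulus_gt0.
have r0 : 0 <= B * modulus z^-1 by rewrite mulr_ge0 ?modulus_ge0.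
have pn0 := orthonormal_neq0 Bz n.+1.
apply/eqP; rewrite -subr_eq0; apply/eqP.
apply: (@modulus_geometric0 _ (modulus (p n.+1).[z]^-1 * (\sum_(i < n.+1) modulus (p i).[z])
   + 1 * (B * modulus z^-1) / (1 - B * modulus z^-1)) (B * modulus z^-1)).
  by rewrite r0.
move=> K.
have h1 := psum_tail ler01 B0 (ratio_coef_le n) rho1 K.+1.
have sz : (size (p n) <= n.+1)%N by rewrite size_p.
have h2 := @eval_remainder_le n.+1 (p n) z K sz ltac:(by rewrite nrm_p).
have h3 := eval_telescope K z0 sz.
rewrite big_nat_recl//= mul0r add0r in h1.
set S := \sum_(0 <= k < K) _ in h1 h3.
have -> : (p n).[z] / (p n.+1).[z] - psum (ratio_coef n) z^-1 =
   (p n.+1).[z]^-1 * ((iter K (trunc n.+1) (p n)).[z] * z^-1 ^+ K)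
   - (psum (ratio_coef n) z^-1 - S).
  by rewrite {1}h3; field.
apply: le_trans (modulusD _ _) _; rewrite modulusN modulusM mulrDl lerD//.
  by rewrite -mulrA ler_wpM2l// modulus_ge0.
by apply: le_trans h1 _; rewrite exprS !mul1r mulrAC.
Qed.

(** * From the matrix to the ratios *)

Lemma topcoef_sum n k (m : nat) (c : nat -> C) (q : nat -> {poly C}) :
  topcoef n (iter k (trunc n) (\sum_(j < m) c j *: q j)) =
  \sum_(j < m) c j * topcoef n (iter k (trunc n) (q j)).
Proof.
elim: m => [|m IH].
  rewrite !big_ord0; have -> : iter k (trunc n) 0 = 0.
    elim: k => //= k ->; rewrite /trunc big1// => i _.
    by rewrite mulr0 ip0l scale0r.
  by rewrite /topcoef mulr0 ip0l.
rewrite !big_ord_recr /= -IH [in LHS]addrC.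
rewrite -[RHS]addrC -topcoef_linear; congr topcoef.
elim: k {IH} => //= k ->; exact: trunc_linear.
Qed.

(** Moving one factor from the left to the right of the power makes this a
linear recurrence in [k] whose coefficients are entries of one fixed column. *)
Lemma topcoef_rec n k i :
  topcoef n (iter k.+1 (trunc n) (p i)) =
  \sum_(j < n) hess j i * topcoef n (iter k (trunc n) (p j)).
Proof. by rewrite iterSr; exact: (topcoef_sum n k n (hess^~ i) p). Qed.

(** Each application of the operator raises the degree by at most one, so a
polynomial of low degree cannot reach [p n] in [k + 1] steps. *)
Lemma topcoef_lower n k j : (j + k.+1 < n)%N -> topcoef n (iter k (trunc n) (p j)) = 0.
Proof.
move=> jkn.
have sz : (size (iter k (trunc n) (p j)) <= j + k.+1)%N.
  have {jkn} : (j + k < n)%N by lia.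
  elim: k => [|k IH] jkn; first by rewrite addn1 size_p.
  have szk : (size (iter k (trunc n) (p j)) <= j + k.+1)%N by apply: IH; lia.
  have h := size_XM szk.
  have /truncE : (size (iter k (trunc n) (p j)) <= n)%N by apply: leq_trans szk _; lia.
  rewrite /topcoef ip_lower_degree ?scale0r ?addr0; last by apply: leq_trans h _; lia.
  by rewrite iterS => <-; rewrite [X in (_ <= X)%N]addnS.
by apply: ip_lower_degree; apply: leq_trans (size_XM sz) _.
Qed.

Lemma sum_top (V : nmodType) (F : nat -> V) n k : (k <= n)%N ->
  \sum_(j < n) F j = \sum_(j < n - k) F j + \sum_(d < k) F (n - d.+1)%N.
Proof.
elim: k => [|k IH] kn; first by rewrite subn0 big_ord0 addr0.
rewrite IH; last exact: ltnW.
rewrite [in RHS]big_ord_recr /= (_ : n - k = (n - k.+1).+1)%N; last by lia.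
by rewrite big_ord_recr /= -!addrA; congr (_ + _); rewrite addrC.
Qed.

Section limits.
Context {F : set_system nat} {FF : ProperFilter F}.

(** By [topcoef_lower] the recurrence only sees the last [k + 1] rows, so the
coefficients are built from finitely many entries near the corner. *)
Lemma cvg_ratio_coef (g : nat -> nat) :
  (forall K, \forall n \near F, (K <= g n)%N) ->
  (forall d e, cvg ((hess (g n - d) (g n - e) : C^o) @[n --> F])) ->
  forall k, cvg ((ratio_coef (g n).-1 k : C^o) @[n --> F]).
Proof.
move=> ginf wind.
have main k d : cvg ((topcoef (g n) (iter k (trunc (g n)) (p (g n - d.+1)%N)) : C^o) @[n --> F]).
  elim: k d => [|k IH] d.
    by have := wind 0%N d.+1; under eq_fun do rewrite subn0.
  apply: (is_cvg_near (v := fun n => \sum_(e < k.+1) hess (g n - e.+1) (g n - d.+1) *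
      topcoef (g n) (iter k (trunc (g n)) (p (g n - e.+1)%N)) : C^o)).
    apply: filterS (ginf k.+1) => n kn.
    rewrite topcoef_rec.
    rewrite (sum_top (fun j => hess j _ * topcoef _ (iter _ _ (p j))) kn).
    rewrite big1 ?add0r// => j _; rewrite topcoef_lower ?mulr0//.
    by have := ltn_ord j; lia.
  by apply: is_cvg_sum => e; apply: is_cvgM; [exact: wind|exact: IH].
case=> [|k]; first exact: is_cvg_cst.
apply: is_cvg_near (main k 0%N); apply: filterS (ginf 1%N) => n gn.
by rewrite /ratio_coef (prednK gn) subn1.
Qed.

End limits.

(** * From the ratios to the matrix *)

Section far.
Variable z : C.
Hypothesis Bz : 4 * B <= modulus z.

Let Bz' : B < modulus z.
Proof. by apply: lt_le_trans Bz; have := B_gt0; lra. Qed.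

Let z_gt0 : 0 < modulus z.
Proof. exact: lt_trans Bz'. Qed.

(** The bound [rho / (1 - rho)] on the series, with [rho = B / |z| <= 1 / 4]. *)
Lemma ratio_far_le n : modulus (p n).[z] <= 2 * B / modulus z * modulus (p n.+1).[z].
Proof.
have B0 := ltW B_gt0; have pn0 := orthonormal_neq0 Bz' n.+1.
rewrite -ler_pdivrMr ?modulus_gt0// -[in leLHS]modulusV -modulusM ratio_psum//.
have rho4 : B / modulus z <= 1 / 4 by rewrite ler_pdivrMr//; have := Bz; lra.
have r0 : 0 <= B / modulus z by rewrite divr_ge0// ltW.
have rho1 : B * modulus z^-1 < 1 by rewrite modulusV; lra.
have := psum_tail ler01 B0 (ratio_coef_le n) rho1 1%N.
rewrite modulusV big_nat1 mul0r subr0 expr1 mul1r => /le_trans; apply.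
rewrite ler_pdivrMr; last lra.
have : B / modulus z * (2 * (1 - B / modulus z) - 1) >= 0 by apply: mulr_ge0 => //; lra.
lra.
Qed.

(** Far from the disc the values [p i] grow at least geometrically, so their sum
is controlled by the last one. *)
Lemma sum_modulus_far_le m : \sum_(i < m.+1) modulus (p i).[z] <= 2 * modulus (p m).[z].
Proof.
elim: m => [|m IH].
  by rewrite big_ord1; have := modulus_ge0 (p 0).[z]; lra.
rewrite big_ord_recr /=.
have h := ratio_far_le m.
have rho4 : 2 * B / modulus z <= 1 / 2 by rewrite ler_pdivrMr//; have := Bz; lra.
have := ler_wpM2r (modulus_ge0 (p m.+1).[z]) rho4.
lra.
Qed.

Lemma hess_sum_far_le m k :
  modulus (\sum_(i < m.+1) hess i k * (p i).[z]) <= 2 * B * modulus (p m).[z].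
Proof.
apply: le_trans (modulus_sum _ _ _) _.
rewrite -mulrA mulrCA.
apply: le_trans (ler_wpM2l (ltW B_gt0) (sum_modulus_far_le m)).
rewrite mulr_sumr ler_sum// => i _; rewrite modulusM ler_wpM2r ?modulus_ge0//.
exact: hess_le.
Qed.

(** The part of a column above row [m] is of order [1 / z] relative to [p m],
uniformly in [m] and [k]. *)
Lemma hess_sum_below_le m k :
  modulus (\sum_(i < m) hess i k * (p i).[z]) <= 4 * B ^+ 2 / modulus z * modulus (p m).[z].
Proof.
case: m => [|m].
  by rewrite big_ord0 modulus0 mulr_ge0 ?modulus_ge0// divr_ge0 ?modulus_ge0// mulr_ge0// sqr_ge0.
apply: le_trans (hess_sum_far_le _ _) _.
have B2 : 0 <= 2 * B by have := B_gt0; lra.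
have := ler_wpM2l B2 (ratio_far_le m).
by rewrite (_ : 2 * B * (_ * _) = 4 * B ^+ 2 / modulus z * modulus (p m.+1).[z]) //; ring.
Qed.

(** In the column identity for [p n] every term except [hess n.+1 n * p n.+1] is
at most a multiple of [p n]; hence the ratio cannot be much smaller than the
subdiagonal entry. *)
Lemma ratio_far_ge n :
  modulus (hess n.+1 n) <= (modulus z + 2 * B) * modulus ((p n).[z] / (p n.+1).[z]).
Proof.
have pn0 := orthonormal_neq0 Bz' n.+1.
rewrite modulusM modulusV mulrA ler_pdivlMr ?modulus_gt0// -modulusM.
have := hess_column_eval z n; rewrite big_ord_recr /= => h.
have -> : hess n.+1 n * (p n.+1).[z] = z * (p n).[z] - \sum_(i < n.+1) hess i n * (p i).[z].
  by rewrite h; ring.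
apply: le_trans (modulusD _ _) _; rewrite modulusN modulusM mulrDl lerD2l.
exact: hess_sum_far_le.
Qed.

End far.

Section limits_converse.
Context {F : set_system nat} {FF : ProperFilter F}.
Variables (t : nat -> nat) (beta r0 : R).
Hypotheses (tinf : forall K, \forall n \near F, (K <= t n)%N)
  (beta_gt0 : 0 < beta)
  (subdiag_ge : \forall n \near \oo, beta <= modulus (hess n.+1 n))
  (cvg_ratio : forall z d, r0 < modulus z ->
     cvg (((p (t n - d.+1)%N).[z] / (p (t n - d)%N).[z] : C^o) @[n --> F])).

Let cvg_ratio_neq0 z d : 4 * B <= modulus z -> r0 < modulus z ->
  exists2 l : C^o, l != 0 &
   ((p (t n - d.+1)%N).[z] / (p (t n - d)%N).[z] : C^o) @[n --> F] --> l.
Proof.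
move=> Bz rz; have /cvg_ex[l ul] := @cvg_ratio z d rz; exists l => //.
have zB : 0 < modulus z + 2 * B by have := B_gt0; lra.
have e0 : 0 < beta / (modulus z + 2 * B) by exact: divr_gt0.
have [N _ hN] := subdiag_ge.
have near_ge : \forall n \near F,
    beta / (modulus z + 2 * B) <= modulus ((p (t n - d.+1)%N).[z] / (p (t n - d)%N).[z]).
  apply: filterS (tinf (N + d.+1)) => n tn.
  rewrite ler_pdivrMr// mulrC.
  have := hN (t n - d.+1)%N => /(_ ltac:(rewrite /=; lia)) /le_trans; apply.
  have -> : (t n - d = (t n - d.+1).+1)%N by lia.
  exact: ratio_far_ge.
have /cvg_modulusP/(_ _ e0) near_lt := ul.
have [n [h1 h2]] := filter_ex (filterI near_ge near_lt).
apply/eqP => l0; rewrite l0 sub0r modulusN in h2; lra.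
Qed.

Let cvg_ratio_lower z d j : 4 * B <= modulus z -> r0 < modulus z ->
  exists2 l : C^o, l != 0 &
   ((p (t n - (d + j))%N).[z] / (p (t n - d)%N).[z] : C^o) @[n --> F] --> l.
Proof.
move=> Bz rz; have pz n : (p n).[z] != 0.
  by apply: orthonormal_neq0; apply: lt_le_trans Bz; have := B_gt0; lra.
elim: j => [|j [l l0 IH]].
  exists 1; rewrite ?oner_neq0//; under eq_fun do rewrite addn0 divff//.
  exact: cvg_cst.
have [l' l'0 h] := cvg_ratio_neq0 (d + j) Bz rz.
exists (l' * l); first by rewrite mulf_neq0.
apply: (cvg_near _ (cvgM h IH)); apply: filterE => n /=.
by rewrite [RHS]mulrA divfK// addnS.
Qed.

Let cvg_ratio_all z d e : 4 * B <= modulus z -> r0 < modulus z ->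
  cvg (((p (t n - e)%N).[z] / (p (t n - d)%N).[z] : C^o) @[n --> F]).
Proof.
move=> Bz rz; have [de|/ltnW ed] := leqP d e.
  rewrite -(subnKC de); have [l _ h] := cvg_ratio_lower d (e - d) Bz rz.
  by apply/cvg_ex; exists l.
rewrite -(subnKC ed); have [l l0 h] := cvg_ratio_lower e (d - e) Bz rz.
apply/cvg_ex; exists l^-1; apply: (cvg_near _ (cvgV l0 h)).
by apply: filterE => n /=; rewrite invf_div.
Qed.

(** Strong induction on the distance from the row just below the diagonal: up to
an error of order [1 / z] uniform in [n], the entry is an expression in ratios
and in the entries below it in the same column. *)
Lemma cvg_hess_column d : cvg ((hess (t n - d) (t n - 1) : C^o) @[n --> F]).
Proof.
elim/ltn_ind: d => d IH; apply: is_cvg_approx => e e0.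
(* Large enough for the estimates far from the disc, for the given convergence
   of the ratios, and for the error [4 * B ^+ 2 / x] to be at most [e]. *)
pose x := Num.max (4 * B) (Num.max (`|r0| + 1) (4 * B ^+ 2 / e)).
have B0 := B_gt0.
have x0 : 0 < x by rewrite lt_max; apply/orP; left; lra.
pose z : C := x%:C%C.
have zx : modulus z = x by rewrite modulus_real gtr0_norm.
have Bz : 4 * B <= modulus z by rewrite zx /x le_max lexx.
have rz : r0 < modulus z.
  rewrite zx /x !lt_max; apply/orP; right; apply/orP; left.
  by have := ler_norm r0; lra.
have ez : 4 * B ^+ 2 / modulus z <= e.
  rewrite ler_pdivrMr ?zx// [e * _]mulrC -ler_pdivrMr//.
  by rewrite /x !le_max lexx !orbT.
have pz n : (p n).[z] != 0.
  by apply: orthonormal_neq0; apply: lt_le_trans Bz; lra.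
(* The column identity divided by [p (t n - d)], without the rows above [t n - d]. *)
exists (fun n => z * ((p (t n - 1)%N).[z] / (p (t n - d)%N).[z]) -
   \sum_(i < d) hess (t n - i) (t n - 1) * ((p (t n - i)%N).[z] / (p (t n - d)%N).[z])).
  apply: is_cvgB.
    by apply: is_cvgM; [exact: is_cvg_cst|exact: cvg_ratio_all].
  apply: is_cvg_sum => i; apply: is_cvgM; last exact: cvg_ratio_all.
  exact: IH (ltn_ord i).
apply: filterS (tinf d.+1) => n tn.
set T := (t n).-1; have tE : t n = T.+1 by rewrite prednK// (leq_ltn_trans _ tn).
have t1 : (t n - 1 = T)%N by rewrite subn1.
have := hess_column_eval z T.
rewrite (@sum_top _ (fun i => hess i T * (p i).[z]) T.+2 d.+1); last by rewrite -tE; lia.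
rewrite big_ord_recr /= t1.
have idx k : (T.+2 - k.+1 = t n - k)%N by rewrite tE subSS.
rewrite idx; under [X in _ + (X + _)]eq_bigr do rewrite idx.
set S1 := \sum_(j < _) _; set S2 := \sum_(i < d) _ => h.
have -> : \sum_(i < d) hess (t n - i) T * ((p (t n - i)%N).[z] / (p (t n - d)%N).[z])
   = S2 / (p (t n - d)%N).[z].
  by rewrite /S2 mulr_suml; apply: eq_bigr => i _; rewrite mulrA.
have -> : hess (t n - d) T - (z * ((p T).[z] / (p (t n - d)%N).[z]) - S2 / (p (t n - d)%N).[z])
   = - (S1 / (p (t n - d)%N).[z]).
  by rewrite mulrA h; field.
rewrite modulusN modulusM modulusV ler_pdivrMr ?modulus_gt0//.
apply: le_trans (hess_sum_below_le Bz _ _) _.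
by rewrite ler_wpM2r ?modulus_ge0.
Qed.

End limits_converse.

(** * The two implications *)

Section right_limits.
Variable N : set nat.
Hypothesis infN : infinite_set N.

Let near_shift (j : int) K : \forall n \near through N, (K <= absz (n%:Z + j)%R)%N.
Proof. by apply: (@near_through N (K + absz j)) => n; lia. Qed.

(** The limit functions are the series of the limit coefficients, which inherit
the geometric bound. *)
Theorem ratio_asymptotics_of_matrix :
  (forall a b : int,
     cvg ((hess (absz (n%:Z + a)%R) (absz (n%:Z + b)%R) : C^o) @[n --> through N])) ->
  ratio_asymptotics p B N.
Proof.
move=> cvH; have B0 := ltW B_gt0; have FF := through_proper infN.
pose u (j : int) n k := ratio_coef (absz (n%:Z + j)%R).-1 k.
have cvu j k : cvg ((u j n k : C^o) @[n --> through N]).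
  apply: cvg_ratio_coef => [K|d e]; first exact: near_shift.
  apply: is_cvg_near (cvH (j - d%:Z) (j - e%:Z)).
  by apply: (@near_through N (absz j + d + e)) => n jn; congr hess; lia.
pose c j k : C := lim ((u j n k : C^o) @[n --> through N]).
have cB j k : modulus (c j k) <= 1 * B ^+ k.
  apply: (modulus_lim_le (cvu j k)) => n; exact: ratio_coef_le.
exists (fun j z => psum (c j) z^-1) => j; split; first exact: analytic_psum_inv.
move=> r Br; apply/cvg_uniform_modulusP => e e0.
have r0 : 0 < r by exact: lt_trans Br.
have Br1 : B * r^-1 < 1 by rewrite ltr_pdivrMr// mul1r.
have rV0 : 0 <= r^-1 by rewrite invr_ge0 ltW.
have Fl : Filter (through N) by exact: within_filter.
have hu := psum_uniform (FF := Fl) (u := u j) ler01 B0 rV0 Br1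
  (fun n => ratio_coef_le (absz (n%:Z + j)%R).-1) (cB j) (cvu j) e0.
have jN : \forall n \near through N, (absz j < n)%N by exact: (@near_through N (absz j).+1).
apply: filterS2 hu jN => n hn jn z rz.
have -> : shifted_ratio p j n z = psum (u j n) z^-1.
  rewrite /u -ratio_psum; last exact: lt_trans rz.
  by rewrite /shifted_ratio; congr ((p _).[z] / (p _).[z]); lia.
apply: hn; rewrite modulusV lef_pV2 ?posrE ?(ltW rz)//; exact: lt_trans rz.
Qed.

(** Entries on and above the first subdiagonal are treated column by column; the
others eventually vanish. *)
Theorem matrix_of_ratio_asymptotics (beta : R) : 0 < beta ->
  (\forall n \near \oo, beta <= kappa p n / kappa p n.+1) ->
  ratio_asymptotics p B N ->
  forall a b : int,
    cvg ((hess (absz (n%:Z + a)%R) (absz (n%:Z + b)%R) : C^o) @[n --> through N]).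
Proof.
move=> beta0 kap [f fP] a b; have FF := through_proper infN.
have kappaE n : kappa p n = modulus (lead_coef (p n)).
  by rewrite /kappa /modulus gtr0_norm.
have subdiag : \forall n \near \oo, beta <= modulus (hess n.+1 n).
  apply: filterS kap => n; rewrite !kappaE -(hess_subdiag n) modulusM mulfK//.
  by rewrite modulus_eq0 gt_eqF.
have cvr z (j : int) : B < modulus z -> cvg ((shifted_ratio p j n z : C^o) @[n --> through N]).
  move=> Bz; apply/cvg_ex; exists (f j z); apply/cvg_modulusP => e e0.
  have [_ fu] := fP j.
  have Br : B < (B + modulus z) / 2 by lra.
  have /cvg_uniform_modulusP/(_ _ e0) := fu _ Br.
  by apply: filterS => n; apply; rewrite /=; lra.
have [ab|ba] := leP a (b + 1).
  (* Column [n + b] is the one just left of column [t n]. *)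
  pose t n := (absz (n%:Z + b)%R).+1.
  have tinf K : \forall n \near through N, (K <= t n)%N.
    by apply: filterS (near_shift b K) => n; rewrite /t; lia.
  have ratio z d : B < modulus z ->
      cvg (((p (t n - d.+1)%N).[z] / (p (t n - d)%N).[z] : C^o) @[n --> through N]).
    move=> Bz; apply: is_cvg_near (cvr z (b + 1 - d%:Z) Bz).
    apply: (@near_through N (absz b + d).+1) => n bn.
    by rewrite /shifted_ratio /t; congr ((p _).[z] / (p _).[z]); lia.
  apply: is_cvg_near (cvg_hess_column tinf beta0 subdiag ratio (d := absz (b + 1 - a)%R)).
  apply: (@near_through N (absz b + absz a).+1) => n bn.
  by rewrite /t; congr hess; lia.
apply: (@is_cvg_near _ _ _ _ _ (fun=> 0)); last exact: is_cvg_cst.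
apply: (@near_through N (absz b + absz a).+1) => n bn.
by apply: hess_lower; lia.
Qed.

End right_limits.

End orthonormal_system.

(** * The inner product of a measure with compact support *)

Section measure_on_disc.
Context {R : realType}.
Local Notation C := R[i].
Variable mu : {finite_measure set (borelC R) -> \bar R}.

Lemma borelC_open (U : set C^o) : open U -> measurable (U : set (borelC R)).
Proof. by move=> oU; apply: sub_sigma_algebra. Qed.

Lemma borelC_continuous (g : C^o -> R) : continuous g ->
  measurable_fun [set: borelC R] (g : borelC R -> R).
Proof.
move=> /continuousP cg; apply: (measurability _ (RGenOInfty.measurableE R)).
move=> /= _ [_ [x ->] <-]; apply: measurableI => //.
by apply: borelC_open; apply: cg; exact: interval_open.
Qed.

Let rational_disc (t : rat * rat * rat) : set C^o :=
  [set y | modulus (y - (ratr t.1.1 +i* ratr t.1.2)%C) < ratr t.2].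

Let open_rational_disc t : open (rational_disc t).
Proof.
rewrite openE => y /= yt; apply/nbhs_modulusP.
exists (ratr t.2 - modulus (y - (ratr t.1.1 +i* ratr t.1.2)%C)).
  by rewrite subr_gt0.
move=> x xy; rewrite /rational_disc /=.
have -> : x - (ratr t.1.1 +i* ratr t.1.2)%C = (x - y) + (y - (ratr t.1.1 +i* ratr t.1.2)%C) by ring.
by apply: le_lt_trans (modulusD _ _) _; rewrite modulusBC; lra.
Qed.

Let rational_disc_basis (z : C) (e : R) : 0 < e ->
  exists2 t, rational_disc t z & forall y, rational_disc t y -> modulus (z - y) < e.
Proof.
move=> e0.
have [a /itvP a_] := @rat_in_itvoo R (complex.Re z - e / 8) (complex.Re z) ltac:(lra).
have [b /itvP b_] := @rat_in_itvoo R (complex.Im z - e / 8) (complex.Im z) ltac:(lra).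
have [r /itvP r_] := @rat_in_itvoo R (e / 4) (e / 2) ltac:(lra).
have zab : modulus (z - (ratr a +i* ratr b)%C) < e / 4.
  apply: le_lt_trans (modulus_le_ReIm _) _; rewrite !raddfB /=.
  have a1 : complex.Re z - e / 8 < ratr a by rewrite a_.
  have a2 : ratr a < complex.Re z by rewrite a_.
  have b1 : complex.Im z - e / 8 < ratr b by rewrite b_.
  have b2 : ratr b < complex.Im z by rewrite b_.
  by rewrite !gtr0_norm; lra.
have r1 : e / 4 < ratr r by rewrite r_.
have r2 : ratr r < e / 2 by rewrite r_.
exists (a, b, r); first by rewrite /rational_disc /=; lra.
move=> y; rewrite /rational_disc /= => yab.
have -> : z - y = (z - (ratr a +i* ratr b)%C) - (y - (ratr a +i* ratr b)%C) by ring.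
by apply: le_lt_trans (modulusD _ _) _; rewrite modulusN; lra.
Qed.

(** The plane being second countable, the complement of the support is a
countable union of open null sets. *)
Lemma supp_negligible : mu.-negligible (~` supp mu : set (borelC R)).
Proof.
pose V n : set (borelC R) := if unpickle n is Some t then
   if mu (rational_disc t) == 0%E then rational_disc t else set0 else set0.
apply: (@negligibleS _ _ _ mu (\bigcup_n V n)); last first.
  apply: negligible_bigcup => n; rewrite /V.
  case: unpickle => [t|]; last exact: negligible_set0.
  case: ifPn => [/eqP m0|_]; last exact: negligible_set0.
  by apply/negligibleP => //; exact: borelC_open.
move=> z /= /existsNP[U /not_implyP[[oU Uz]]].
move=> /negP; rewrite lt0e measure_ge0 andbT negbK => /eqP U0.
have /nbhs_modulusP[e e0 eU] := open_nbhs_nbhs (conj oU Uz).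
have [t tz tU] := rational_disc_basis z e0.
have mt0 : mu (rational_disc t) = 0%E.
  apply/eqP; rewrite -measure_le0 -U0.
  apply: le_measure; rewrite ?inE; [exact: borelC_open|exact: borelC_open|].
  by move=> y /tU; exact: eU.
by exists (pickle t); [exact: I|rewrite /V pickleK mt0 eqxx].
Qed.

Hypothesis cS : compact (supp mu).
Let B := outer_radius mu.

Let supp_has_ubound : has_ubound [set modulus z | z in supp mu].
Proof.
have cm : compact [set modulus z | z in supp mu].
  apply: continuous_compact => //; apply: continuous_subspaceT.
  exact: continuous_modulus.
have [M [_ hM]] := @compact_bounded R R^o _ cm.
exists (M + 1) => _ [z Sz <-].
have := hM (M + 1) ltac:(by rewrite ltrDl) (modulus z) (ex_intro2 _ _ z Sz erefl).
exact: le_trans (ler_norm _).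
Qed.

Lemma outer_radius_ge z : supp mu z -> modulus z <= outer_radius mu.
Proof. by move=> Sz; apply: ub_le_sup => //; exists z. Qed.

Lemma outer_radius_gt0 : infinite_set (supp mu) -> 0 < outer_radius mu.
Proof.
move=> infS; have [z Sz z0] : exists2 z, supp mu z & z != 0.
  apply: contrapT => h; apply: infS.
  apply: (@sub_finite_set _ _ [set (0 : C^o)]); last exact: finite_set1.
  move=> z Sz /=; apply: contrapT => /eqP z0; apply: h; by exists z.
by apply: lt_le_trans (outer_radius_ge Sz); rewrite modulus_gt0.
Qed.

Let far : set (borelC R) := [set z | B < modulus z].

Let measurable_far : measurable far.
Proof.
apply: borelC_open; have /continuousP := @continuous_modulus R => /(_ [set x | B < x]).
by apply; exact: open_gt.
Qed.

Let mu_far : mu far = 0%E.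
Proof.
apply/negligibleP => //; apply: negligibleS supp_negligible => z Bz Sz.
by have := lt_le_trans Bz (outer_radius_ge Sz); rewrite ltxx.
Qed.

Let disc : set (borelC R) := setT `\` far.

Let measurable_disc : measurable disc.
Proof. exact: measurableD. Qed.

Let discP z : disc z -> modulus z <= B.
Proof. by move=> [_ /negP]; rewrite -leNgt. Qed.

(** A class of functions that is stable under the operations building the inner
product, and integrable because [mu] is finite and carried by the disc. *)
Let tame (f : C -> C) := continuous (f : C^o -> C^o) /\
  exists K : R, forall z, modulus z <= B -> modulus (f z) <= K.

Let integrable_tame (f : C -> C) (g : C^o -> R) : tame f -> continuous g ->
  (forall z, `|g z| <= modulus z) ->
  mu.-integrable setT (EFin \o (g \o f : borelC R -> R)).
Proof.
move=> [cf [K fK]] cg gle.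
have mf : measurable_fun [set: borelC R] (g \o f : borelC R -> R).
  apply: borelC_continuous => z; apply: continuous_comp; [exact: cf|exact: cg].
apply/(negligible_integrable (N := far)) => //; first exact/measurable_EFinP.
apply: measurable_bounded_integrable => //.
- by rewrite ltey_eq fin_num_measure.
- exact: measurable_funS mf.
exists K; split; first exact: num_real.
move=> M KM z /discP zB /=; apply: le_trans (gle _) _.
by apply: le_trans (ltW KM); exact: fK.
Qed.

Let iRe f : tame f -> mu.-integrable setT (EFin \o (fun z : borelC R => complex.Re (f z))).
Proof.
by move=> tf; apply: (integrable_tame tf (@continuous_Re R)); exact: Re_le_modulus.
Qed.

Let iIm f : tame f -> mu.-integrable setT (EFin \o (fun z : borelC R => complex.Im (f z))).
Proof.
by move=> tf; apply: (integrable_tame tf (@continuous_Im R)); exact: Im_le_modulus.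
Qed.

Let tameM f g : tame f -> tame g -> tame (fun z => f z * g z).
Proof.
move=> [cf [K fK]] [cg [L gL]]; split.
  by move=> z; exact: (cvgM (cf z) (cg z)).
exists (K * L) => z zB; rewrite modulusM.
by rewrite ler_pM ?modulus_ge0 ?fK ?gL.
Qed.

Let tameD f g : tame f -> tame g -> tame (fun z => f z + g z).
Proof.
move=> [cf [K fK]] [cg [L gL]]; split.
  by move=> z; exact: (cvgD (cf z) (cg z)).
exists (K + L) => z zB; apply: le_trans (modulusD _ _) _.
by rewrite lerD ?fK ?gL.
Qed.

Let tame_cst (c : C) : tame (fun=> c).
Proof. by split; [exact: cst_continuous|exists (modulus c)]. Qed.

Let tame_id : tame id.
Proof. by split; [move=> z A hA; exact: hA|exists B]. Qed.

Let tame_conj f : tame f -> tame (fun z => (f z)^*%C).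
Proof.
move=> [cf [K fK]]; split; last first.
  by exists K => z /fK; rewrite modulus_conj.
move=> z; have FF := @nbhs_filter C^o z.
have h := proj1 (@cvg_modulusP _ C^o (nbhs (z : C^o)) FF f (f z)) (cf z).
apply: (proj2 (@cvg_modulusP _ C^o (nbhs (z : C^o)) FF (fun z => (f z)^*%C) (f z)^*%C)) => e /h.
by apply: filterS => y; rewrite -[X in X < _ -> _]modulus_conj rmorphB.
Qed.

Let tame_horner (q : {poly C}) : tame (horner q).
Proof.
elim/poly_ind: q => [|q c IH].
  by rewrite (_ : horner 0 = fun=> 0) //; apply/funext => z; rewrite horner0.
rewrite (_ : horner _ = fun z => q.[z] * z + c).
  by apply: tameD => //; exact: tameM.
by apply/funext => z; rewrite hornerMXaddC.
Qed.

Let cintegralD f g : tame f -> tame g ->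
  cintegral mu (fun z => f z + g z) = cintegral mu f + cintegral mu g.
Proof.
move=> tf tg; rewrite /cintegral.
have -> : (fun z : borelC R => complex.Re (f z + g z)) = fun z => complex.Re (f z) + complex.Re (g z).
  by apply/funext => z; rewrite raddfD.
have -> : (fun z : borelC R => complex.Im (f z + g z)) = fun z => complex.Im (f z) + complex.Im (g z).
  by apply/funext => z; rewrite raddfD.
rewrite !RintegralD//; [exact: iIm|exact: iIm|exact: iRe|exact: iRe].
Qed.

Let cintegralZ (c : C) f : tame f ->
  cintegral mu (fun z => c * f z) = c * cintegral mu f.
Proof.
move=> tf; rewrite /cintegral; case: c => a b.
have iZ k (g : borelC R -> R) : mu.-integrable setT (EFin \o g) ->
   mu.-integrable setT (EFin \o (fun z => k * g z)).
  by move=> ig; exact: (integrableZl measurableT k ig).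
have -> : (fun z : borelC R => complex.Re ((a +i* b)%C * f z)) =
    fun z => a * complex.Re (f z) - b * complex.Im (f z).
  by apply/funext => z; case: (f z).
have -> : (fun z : borelC R => complex.Im ((a +i* b)%C * f z)) =
    fun z => a * complex.Im (f z) + b * complex.Re (f z).
  by apply/funext => z; case: (f z).
have [h1 h2] := (iRe tf, iIm tf).
rewrite RintegralB ?RintegralD//; try exact: iZ.
by rewrite !RintegralZl.
Qed.

Definition inner (q s : {poly C}) : C := cintegral mu (fun z => q.[z] * (s.[z])^*%C).

Lemma inner_linear (c : C) q s t : inner (c *: q + s) t = c * inner q t + inner s t.
Proof.
rewrite /inner -cintegralZ -?cintegralD; last first.
- by apply: tameM; [exact: tame_horner|apply: tame_conj; exact: tame_horner].
- by apply: tameM; [exact: tame_horner|apply: tame_conj; exact: tame_horner].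
- by apply: tameM => //; apply: tameM; [exact: tame_horner|apply: tame_conj; exact: tame_horner].
by congr cintegral; apply/funext => z; rewrite hornerD hornerZ mulrDl mulrA.
Qed.

Lemma inner_conj q s : inner q s = (inner s q)^*%C.
Proof.
have tm : tame (fun z => s.[z] * (q.[z])^*%C).
  by apply: tameM; [exact: tame_horner|apply: tame_conj; exact: tame_horner].
rewrite /inner /cintegral.
have -> : (fun z : borelC R => complex.Re (q.[z] * (s.[z])^*%C)) =
   fun z => complex.Re (s.[z] * (q.[z])^*%C).
  by apply/funext => z; case: (q.[z]) => a b; case: (s.[z]) => c d /=; ring.
have -> : (fun z : borelC R => complex.Im (q.[z] * (s.[z])^*%C)) =
   fun z => (-1) * complex.Im (s.[z] * (q.[z])^*%C).
  by apply/funext => z; case: (q.[z]) => a b; case: (s.[z]) => c d /=; ring.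
by rewrite RintegralZl ?mulN1r//; exact: iIm.
Qed.

(** The measure is carried by the disc, where [|z q|] is at most [B * |q|]. *)
Lemma inner_X_le q :
  complex.Re (inner ('X * q) ('X * q)) <= B ^+ 2 * complex.Re (inner q q).
Proof.
have tm s : tame (fun z => s.[z] * (s.[z])^*%C).
  by apply: tameM; [exact: tame_horner|apply: tame_conj; exact: tame_horner].
rewrite /inner /cintegral /= -RintegralZl//; last exact: iRe.
have i1 := iRe (tm ('X * q)).
have i2 : mu.-integrable setT (EFin \o (fun z : borelC R => B ^+ 2 * complex.Re (q.[z] * (q.[z])^*%C))).
  exact: (integrableZl measurableT (B ^+ 2) (iRe (tm q))).
rewrite /Rintegral (negligible_integral measurable_far _ i1 mu_far)//.
rewrite (negligible_integral measurable_far _ i2 mu_far)//.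
apply: le_Rintegral => //.
- by apply: integrableS i1.
- by apply: integrableS i2.
move=> z /discP zB; rewrite !modulus_sqr hornerM hornerX modulusM exprMn.
rewrite ler_wpM2r ?sqr_ge0//.
by have := modulus_ge0 z; nra.
Qed.

End measure_on_disc.

(** * The equivalence *)

Theorem theorem1p2 (R : realType)
    (mu : {finite_measure set (borelC R) -> \bar R})
    (p : nat -> {poly R[i]}) (N : set nat) :
  compact (supp mu) -> infinite_set (supp mu) ->
  orthonormal_polynomials mu p ->
  infinite_set N ->
  ((0 < limn_einf (fun n => (kappa p n / kappa p n.+1)%:E))%E ->
     (ratio_asymptotics p (outer_radius mu) N <->
      approaches_right_limit (bergman_shift mu p) N)) /\
  (approaches_right_limit (bergman_shift mu p) N ->
     ratio_asymptotics p (outer_radius mu) N).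
Proof.
move=> cS infS [size_p lead_p ortho] infN.
have B_gt0 := outer_radius_gt0 cS infS.
have il := inner_linear cS; have ic := inner_conj cS; have iX := inner_X_le cS.
have bergmanE i k : bergman_shift mu p i.+1 k.+1 = hess p (inner mu) i k.
  by congr cintegral; apply/funext => z; rewrite /= hornerM hornerX.
(* The shift by one between the two indexings is absorbed by the offsets. *)
have matrixP : approaches_right_limit (bergman_shift mu p) N <->
    forall a b : int, cvg ((hess p (inner mu) (absz (n%:Z + a)%R) (absz (n%:Z + b)%R) : R[i]^o)
      @[n --> through N]).
  have FF := through_proper infN.
  split=> [/right_limitP h a b|h].
    apply: is_cvg_near (h (a + 1) (b + 1)).
    apply: (@near_through N (absz a + absz b)) => n abn.
    by rewrite -bergmanE; congr bergman_shift; lia.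
  apply/right_limitP => a b; apply: is_cvg_near (h (a - 1) (b - 1)).
  apply: (@near_through N (absz a + absz b).+1) => n abn.
  by rewrite -bergmanE; congr bergman_shift; lia.
have II_I : approaches_right_limit (bergman_shift mu p) N ->
    ratio_asymptotics p (outer_radius mu) N.
  move=> /matrixP; exact: (ratio_asymptotics_of_matrix size_p lead_p il ic ortho B_gt0 iX infN).
split=> // /limn_einf_gt0[beta beta0 kap]; split=> // h; apply/matrixP.
exact: (matrix_of_ratio_asymptotics size_p lead_p il ic ortho B_gt0 iX infN beta0 kap h).
Qed.
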